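(* Let $\phi\in E_Q=\mathrm{End}_{Q_W}(Q_{W/W_P}^* )$ and write $\phi(f_1)=\sum_{w\in W^P}c_wf_w$ with $c_w\in Q$. Then $\phi$ comes from $E_D=\mathrm{End}_D(D_P^\star)$ (i.e. lies in the image of the natural inclusion $E_D\hookrightarrow E_Q$) if and only if for all $w\in W^P$ its coefficients satisfy $$x_{\Pi/P}\,c_w\in S\quad\text{and}\quad x_{w(\alpha)}\ \big|\ x_{\Pi/P}\,\big(c_w-c_{\overline{s_{w(\alpha)}w}}\big)\ \text{ in } S\ \text{ for all }\alpha\in\Sigma\setminus\Sigma_P.$$
   Context: Let $G$ be a split reductive group over a field of characteristic $0$, $T\subset B\subset P$ a split maximal torus, Borel and standard parabolic subgroup, $T^*$ the character lattice, $\Sigma$ the root system, $\Sigma_P\subset\Sigma$ the root subsystem for $P$ (its Levi part), $\Sigma^-$, $\Sigma_P^-$ the sets of negative roots, $W$ and $W_P$ the Weyl groups, $W^P$ the set of minimal length representatives of $W/W_P$; for $w\in W$, $\overline w\in W^P$ is the minimal representative of $wW_P$; $s_\beta$ is the reflection in the root $\beta$. Let $F$ be a formal group law over a commutative ring $R$ (that of an oriented cohomology theory) and $S=R[[x_\lambda]]_{\lambda\in T^*}/(x_0,\,x_{\lambda+\mu}-F(x_\lambda,x_\mu))$ (quotient by the closed ideal), with $W$ acting by $w(x_\lambda)=x_{w(\lambda)}$. Standing assumption: every $x_\alpha$, $\alpha\in\Sigma$, is regular in $S$. Let $Q$ be the localization of $S$ at all $x_\alpha$, and $Q_W$ the twisted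 group algebra: the free left $Q$-module on $\delta_w$, $w\in W$, with $(q\delta_w)(q'\delta_{w'})=q\,w(q')\delta_{ww'}$. Let $D\subset Q_W$ be the subalgebra generated by $S$ and all $X_\alpha=x_\alpha^{-1}(1-\delta_{s_\alpha})$, $\alpha\in\Sigma$. Let $Q_{W/W_P}$ be the free $Q$-module on $\{\delta_w\}_{w\in W^P}$, $p\colon Q_W\to Q_{W/W_P}$, $q\delta_w\mapsto q\delta_{\overline w}$, $D_P=p(D)$. Let $Q_{W/W_P}^*=\mathrm{Hom}_Q(Q_{W/W_P},Q)$ with dual basis $\{f_w\}_{w\in W^P}$, and $D_P^\star=\mathrm{Hom}_S(D_P,S)=\{f\in Q_{W/W_P}^*: f(D_P)\subset S\}$. The $\odot$-action of $Q_W$ on $Q_{W/W_P}^*$ is $q\delta_w\odot pf_v=q\,w(p)f_{\overline{wv}}$ ($q,p\in Q$, $w\in W$, $v\in W^P$); it restricts to an action of $D$ on $D_P^\star$, and all module structures are with respect to it. The inclusion $E_D\hookrightarrow E_Q$ is induced by the localization $D\subset Q_W$ (extension of scalars from $S$ to $Q$). Put $x_\Pi=\prod_{\alpha\in\Sigma^-}x_\alpha$, $x_P=\prod_{\alpha\in\Sigma_P^-}x_\alpha$ and $x_{\Pi/P}=x_\Pi/x_P$. The element $[\mathrm{pt}]=x_{\Pi/P}f_1$ lies in $D_P^\star$ and generates it as a $D$-module. Setting for membership in $D_P^\star$: one is in the situation where the known criterion of Calmès–Zainoulline–Zhong holds, i.e. an element $\sum_{w\in W^P}g_wf_w$ with $g_w\in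 Q$ belongs to $D_P^\star$ if and only if all $g_w\in S$ and $x_{w(\alpha)}\mid g_w-g_{\overline{s_{w(\alpha)}w}}$ for all $w\in W^P$ and $\alpha\in\Sigma\setminus\Sigma_P$. *)

(* Defs.v *)
From HB Require Import structures.
From mathcomp Require Import all_boot all_order all_fingroup all_algebra.
From mathcomp Require Import boolp finmap.
From mathcomp.multinomials Require Import monalg.

Set Implicit Arguments.
Unset Strict Implicit.
Unset Printing Implicit Defensive.

Import GRing.Theory.
Local Open Scope ring_scope.
Local Open Scope quotient_scope.

(* A[[t]]: the element f is the series \sum_n f n t^n. *)

Definition fps (A : comNzRingType) : Type := nat -> A.

Section FPS.
Variable A : comNzRingType.
Implicit Types f g h : fps A.

HB.instance Definition _ := gen_eqMixin (fps A).
HB.instance Definition _ := gen_choiceMixin (fps A).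

Definition fps0 : fps A := fun _ => 0.
Definition fps1 : fps A := fun n => (n == 0%N)%:R.
Definition fps_opp f : fps A := fun n => - f n.
Definition fps_add f g : fps A := fun n => f n + g n.
Definition fps_mul f g : fps A := fun n => \sum_(i < n.+1) f i * g (n - i)%N.

Fact fps_addA : associative fps_add.
Proof. by move=> f g h; apply/funext => n; exact: addrA. Qed.
Fact fps_addC : commutative fps_add.
Proof. by move=> f g; apply/funext => n; exact: addrC. Qed.
Fact fps_add0 : left_id fps0 fps_add.
Proof. by move=> f; apply/funext => n; exact: add0r. Qed.
Fact fps_addN : left_inverse fps0 fps_opp fps_add.
Proof. by move=> f; apply/funext => n; exact: addNr. Qed.

HB.instance Definition _ :=
  GRing.isZmodule.Build (fps A) fps_addA fps_addC fps_add0 fps_addN.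

Definition fps_trunc N f : {poly A} := \poly_(i < N.+1) f i.

Fact coef_trunc N f i : (i <= N)%N -> (fps_trunc N f)`_i = f i.
Proof. by move=> le_iN; rewrite coef_poly ltnS le_iN. Qed.

Fact fps_mulE N f g n :
  (n <= N)%N -> fps_mul f g n = (fps_trunc N f * fps_trunc N g)`_n.
Proof.
move=> le_nN; rewrite coefM; apply: eq_bigr => i _.
have le_in : (i <= n)%N by rewrite -ltnS.
by rewrite !coef_trunc // ?(leq_trans le_in) // (leq_trans (leq_subr _ _)).
Qed.

Fact fps_mulC : commutative fps_mul.
Proof. by move=> f g; apply/funext => n; rewrite !(@fps_mulE n) // mulrC. Qed.

Fact fps_mulA : associative fps_mul.
Proof.
move=> f g h; apply/funext => n.
transitivity (fps_trunc n f * (fps_trunc n g * fps_trunc n h))`_n.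
  rewrite coefM; apply: eq_bigr => i _; have le_in : (i <= n)%N by rewrite -ltnS.
  by rewrite coef_trunc // (@fps_mulE n) // leq_subr.
rewrite mulrA coefM; apply: eq_bigr => i _.
have le_in : (i <= n)%N by rewrite -ltnS.
by rewrite (@fps_mulE n) // coef_trunc // leq_subr.
Qed.

Fact fps_mul1 : left_id fps1 fps_mul.
Proof.
move=> f; apply/funext => n; rewrite /fps_mul big_ord_recl /= mul1r subn0.
by rewrite big1 ?addr0 // => i _; rewrite mul0r.
Qed.

Fact fps_mulDl : left_distributive fps_mul fps_add.
Proof.
move=> f g h; apply/funext => n; rewrite /fps_mul /fps_add -big_split /=.
by apply: eq_bigr => i _; rewrite mulrDl.
Qed.

Fact fps1_neq0 : fps1 != 0.
Proof. by apply/eqP => /(congr1 (fun f : fps A => f 0%N))/eqP; rewrite oner_eq0. Qed.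

HB.instance Definition _ := GRing.Zmodule_isComNzRing.Build (fps A)
  fps_mulA fps_mulC fps_mul1 fps_mulDl fps1_neq0.

End FPS.

(* R[[x_i]]_(i in I), for a possibly infinite set I of variables, is the
   completion of the polynomial ring R[x_i] at its augmentation ideal: a series
   is a sequence of polynomials, the d-th one being homogeneous of degree d.  It
   is realized as a subring of R[x_i][[t]]. *)

Section MPS.
Variables (R : comNzRingType) (I : choiceType).

Definition homog : {pred fps {malg R[{cmonom I}]}} :=
  fun f => `[< forall d m, (f d)@_m != 0 -> mdeg m = d >].

Fact homogP f : reflect (forall d m, (f d)@_m != 0 -> mdeg m = d) (f \in homog).
Proof. exact: asboolP. Qed.

Fact homog_subring : subring_closed homog.
Proof.
split=> [|f g /homogP hf /homogP hg|f g /homogP hf /homogP hg]; apply/homogP.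
- move=> [|d] m; last by rewrite mcoeff0 eqxx.
  rewrite (_ : (1 : fps {malg R[{cmonom I}]}) 0%N = 1) // mcoeff1.
  by have [-> _|_] := eqVneq m mone; rewrite ?mdeg1 ?eqxx.
- move=> d m; have -> : (f - g) d = f d - g d by [].
  rewrite mcoeffB; have [/hf //|] := boolP ((f d)@_m != 0).
  by rewrite negbK => /eqP ->; rewrite sub0r oppr_eq0; exact: hg.
- move=> d m; have -> : (f * g) d = \sum_(i < d.+1) f i * g (d - i)%N by [].
  rewrite raddf_sum /=; apply: contra_neq_eq => hm; apply: big1 => i _.
  apply/eqP; apply: contra_neqT hm; rewrite mcoeff_neq0.
  case/msuppM_le=> m1 [m2 [+ + ->]]; rewrite -!mcoeff_neq0 => /hf hm1 /hg hm2.
  by rewrite mdegM hm1 hm2 subnKC // -ltnS.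
Qed.

HB.instance Definition _ := GRing.isSubringClosed.Build _ homog homog_subring.

Record mps := MPS { mps_val : fps {malg R[{cmonom I}]}; _ : mps_val \in homog }.

Definition mps_coef (f : mps) : nat -> {malg R[{cmonom I}]} := mps_val f.
Coercion mps_coef : mps >-> Funclass.

HB.instance Definition _ := [isSub for mps_val].
HB.instance Definition _ := [Choice of mps by <:].
HB.instance Definition _ := [SubChoice_isSubComNzRing of mps by <:].

Fact mps_var_subproof (i : I) :
  (fun d => if d == 1%N then << ucm i >> else 0) \in homog.
Proof.
apply/homogP => d m; have [->|_] := eqVneq d 1%N; last by rewrite mcoeff0 eqxx.
by rewrite mcoeffU1; have [<- _|_] := eqVneq (ucm i) m; rewrite ?mdegU ?eqxx.
Qed.
Definition mps_var i : mps := MPS (mps_var_subproof i).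

(* \sum_(i, j) a i j p^i q^j, meaningful when p and q have no constant term:
   then only the terms with i, j <= d contribute in degree d. *)
Fact mps_eval2_subproof (a : nat -> nat -> R) (p q : mps) :
  (fun d => \sum_(i < d.+1) \sum_(j < d.+1)
     a i j *: (p ^+ i * q ^+ j) d) \in homog.
Proof.
apply/homogP => d m; rewrite raddf_sum; apply: contra_neq_eq => hm.
apply: big1 => i _; rewrite raddf_sum; apply: big1 => j _ /=.
apply/eqP; rewrite mcoeffZ; apply: contra_neqT hm => /eqP hm.
have /homogP := valP (p ^+ i * q ^+ j); apply.
by apply/eqP => h; apply: hm; rewrite h mulr0.
Qed.
Definition mps_eval2 a p q : mps := MPS (mps_eval2_subproof a p q).

(* The topology of R[[x_i]] is the one defined by the degree filtration. *)
Definition mps_closed (E : mps -> Prop) :=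
  forall f : mps,
    (forall n, exists2 g : mps, E g & forall d, (d < n)%N -> f d = g d) -> E f.

Definition mps_ideal (E : mps -> Prop) :=
  [/\ E 0, forall f g, E f -> E g -> E (f + g) & forall f g, E g -> E (f * g)].

End MPS.

Section Rename.
Variables (R : comNzRingType) (I J : choiceType) (h : I -> J).

Definition cmonom_rename (m : {cmonom I}) : {cmonom J} :=
  \big[mmul/mone]_(i <- finsupp m) \big[mmul/mone]_(k < m i) ucm (h i).

Definition malg_rename (p : {malg R[{cmonom I}]}) : {malg R[{cmonom J}]} :=
  \sum_(m <- msupp p) << p@_m *g cmonom_rename m >>.

Fact cmonom_rename_deg m : mdeg (cmonom_rename m) = mdeg m.
Proof.
rewrite mdeg_prod mdegE; apply: eq_bigr => i _; rewrite mdeg_prod.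
under eq_bigr do rewrite mdegU.
by rewrite sum1_card card_ord.
Qed.

Fact mps_rename_subproof (f : mps R I) :
  (fun d => malg_rename (f d)) \in @homog R J.
Proof.
apply/homogP => d m; rewrite raddf_sum; apply: contra_neq_eq => hm /=.
rewrite big_seq; apply: big1 => m' hm'; rewrite mcoeffU.
have [E|] := eqVneq; last by [].
case/negP: hm; apply/eqP; rewrite -E cmonom_rename_deg.
by have /homogP := valP f; apply; rewrite mcoeff_neq0.
Qed.

(* The continuous R-algebra morphism x_i |-> x_(h i) *)
Definition mps_rename (f : mps R I) : mps R J := MPS (mps_rename_subproof f).

End Rename.

(* F(u, v) = \sum_(i, j) fgl_coef i j u^i v^j *)
Record fgl (R : comNzRingType) := Fgl {
  fgl_coef : nat -> nat -> R;
  fgl_coef0 : forall i, fgl_coef i 0%N = (i == 1%N)%:R;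
  fgl_coefC : forall i j, fgl_coef i j = fgl_coef j i;
  fgl_coefA :
    let F := @mps_eval2 R 'I_3 fgl_coef in
    let x := @mps_var R 'I_3 in
    F (x 0) (F (x 1) (x (1 + 1))) = F (F (x 0) (x 1)) (x (1 + 1))
}.

Section FormalGroupRing.
Variables (R : comNzRingType) (F : fgl R) (M : zmodType).

Local Notation X := (@mps_var R M).

Definition fgr_rel (f : mps R M) : Prop :=
  f = X 0 \/
  exists a b : M, f = X (a + b) - mps_eval2 (fgl_coef F) (X a) (X b).

(* The smallest closed ideal containing the relations *)
Definition fgr_ideal : {pred mps R M} := fun f =>
  `[< forall E, mps_ideal E -> mps_closed E ->
        (forall g, fgr_rel g -> E g) -> E f >].

Fact fgr_ideal_closed : idealr_closed fgr_ideal.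
Proof.
split.
- by apply/asboolP => E [].
- apply/asboolPn => /(_ (fun f : mps R M => f 0%N = 0)) h.
  suff: (1 : mps R M) 0%N = 0 by apply/eqP; exact: oner_neq0.
  apply: h.
  + split=> //.
    * by move=> f g f0 g0; rewrite (_ : (f + g : mps R M) 0%N = f 0%N + g 0%N) // f0 g0 addr0.
    * move=> f g g0; rewrite (_ : (f * g : mps R M) 0%N = \sum_(i < 1) f i * g (0 - i)%N) //.
      by rewrite big_ord1 g0 mulr0.
  + by move=> f /(_ 1%N) [g g0 ->].
  + move=> _ [->//|[a [b ->]]].
    rewrite (_ : (X (a + b) - mps_eval2 (fgl_coef F) (X a) (X b) : mps R M) 0%N =
        - (mps_eval2 (fgl_coef F) (X a) (X b)) 0%N); last exact: sub0r.
    rewrite /= !big_ord1 fgl_coef0.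
    by rewrite scale0r oppr0.
- move=> a f g /asboolP hf /asboolP hg; apply/asboolP => E idE cE gE.
  have [_ EA EM] := idE.
  by apply: EA; [apply: EM; exact: hf|exact: hg].
Qed.

HB.instance Definition _ := isIdealr.Build _ fgr_ideal fgr_ideal_closed.

Definition fgr := {ideal_quot fgr_ideal}.

HB.instance Definition _ := GRing.ComNzRing.on fgr.

Definition fgr_x (a : M) : fgr := \pi_{ideal_quot fgr_ideal} (X a).

(* The continuous ring endomorphism x_a |-> x_(h a), for h an additive
   endomorphism of M: the value does not depend on the representative. *)
Definition fgr_map (h : M -> M) (s : fgr) : fgr :=
  \pi_{ideal_quot fgr_ideal}
    (mps_rename h (generic_quotient.repr (s : {ideal_quot fgr_ideal}))).

End FormalGroupRing.

(* A split reductive group with a split maximal torus enters only through its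
   root datum.  The character lattice T^* is Z^r (column vectors), its dual
   consists of row vectors, and the roots are indexed by a finite type. *)

Record root_datum := RootDatum {
  rk : nat;
  ridx : finType;
  root : ridx -> 'cV[int]_rk;
  coroot : ridx -> 'rV[int]_rk;
  root_inj : injective root;
  coroot_inj : injective coroot;
  root_pairing : forall a, (coroot a *m root a) 0 0 = 2;
  root_refl : forall a b, exists c,
    root c = root b - root a *m (coroot a *m root b);
  coroot_refl : forall a b, exists c,
    coroot c = coroot b - (coroot b *m root a) *m coroot a;
  root_reduced : forall a b (k l : int),
    k != 0 -> root b *~ k = root a *~ l -> root b = root a \/ root b = - root a
}.

Definition reflection_mx (D : root_datum) (a : ridx D) : 'M[int]_(rk D) :=
  1%:M - root a *m coroot a.

(* The Weyl group, given as a finite group with a faithful representation on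
   T^* whose image is generated by the reflections; this determines it up to a
   unique isomorphism. *)
Record weyl_group (D : root_datum) := WeylGroup {
  weyl_sort :> finGroupType;
  weyl_mx : weyl_sort -> 'M[int]_(rk D);
  weyl_mx1 : weyl_mx 1%g = 1%:M;
  weyl_mxM : forall u v, weyl_mx (u * v)%g = weyl_mx u *m weyl_mx v;
  weyl_mx_inj : injective weyl_mx;
  srefl : ridx D -> weyl_sort;
  srefl_mx : forall a, weyl_mx (srefl a) = reflection_mx a;
  weyl_gen : <<[set srefl a | a : ridx D]>>%g = [set: weyl_sort]
}.

Section RootAction.
Variables (D : root_datum) (W : weyl_group D).

Fact wroot_subproof (w : W) (a : ridx D) :
  exists b, root b == weyl_mx w *m root a.
Proof.
have /gen_prodgP [n [c Hc ->]] : w \in <<[set srefl W a | a : ridx D]>>%g.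
  by rewrite weyl_gen inE.
elim: n c Hc => [|n IHn] c Hc.
  by exists a; rewrite big_ord0 weyl_mx1 mul1mx.
rewrite big_ord_recl weyl_mxM.
have [|b /eqP Eb] := IHn (fun i => c (lift ord0 i)); first by move=> i.
have /imsetP [a0 _ ->] := Hc ord0.
have [b' Eb'] := root_refl a0 b.
exists b'; rewrite Eb' srefl_mx /reflection_mx -mulmxA -Eb.
by rewrite mulmxBl mul1mx mulmxA.
Qed.

(* The index of the root w(a) *)
Definition wroot w a : ridx D := xchoose (wroot_subproof w a).

End RootAction.

(* A Borel subgroup containing T is given by a base of the root system. *)
Record base (D : root_datum) := Base {
  simple : {set ridx D};
  simple_free : forall k : ridx D -> int,
    \sum_(b in simple) root b *~ k b = 0 -> forall b, b \in simple -> k b = 0;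
  simple_span : forall a, exists k : ridx D -> nat,
    root a = \sum_(b in simple) root b *+ k b \/
    root a = - \sum_(b in simple) root b *+ k b
}.

Section Parabolic.
Variables (D : root_datum) (W : weyl_group D) (B : base D).

Definition negative_root (a : ridx D) : bool :=
  `[< exists k : ridx D -> nat, root a = - \sum_(b in simple B) root b *+ k b >].

(* A standard parabolic subgroup is given by a subset P of the base; the roots
   of its Levi part are the roots in the span of P. *)
Variable P : {set ridx D}.

Definition levi_root (a : ridx D) : bool :=
  `[< exists k : ridx D -> int, root a = \sum_(b in P) root b *~ k b >].

Definition WP_group : {group W} := <<[set srefl W a | a in P]>>%G.

(* The length for the simple reflections: A ^+ k is the set of products of k
   elements of A, and the length of any element is less than #|W|. *)
Definition weyl_length (w : W) : nat :=
  find (fun k => w \in [set srefl W a | a in simple B] ^+ k)%g (iota 0 #|W|).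

Definition minreps : {set W} :=
  [set w | [forall u in WP_group, weyl_length w <= weyl_length (w * u)%g]%N].

Definition Wquo : finType := {w : W | w \in minreps}.

Definition minrep_of (w : W) : W :=
  [arg min_(u < w in (w *: WP_group)%g) weyl_length u].

Fact minrep_of_subproof w : minrep_of w \in minreps.
Proof.
rewrite /minrep_of; case: arg_minnP => [|u uw min_u]; first exact: lcoset_refl.
rewrite inE; apply/forall_inP => v vP; apply: min_u.
by rewrite -(lcoset_eqP uw) mem_lcoset mulKg.
Qed.

(* The minimal representative of w W_P *)
Definition minrep (w : W) : Wquo := exist _ (minrep_of w) (minrep_of_subproof w).

End Parabolic.

(* A localization of S at the multiplicative set generated by the elements
   satisfying X, characterized up to a unique isomorphism *)
Record localization (S : comNzRingType) (X : S -> Prop) := Localization {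
  loc_ring :> comUnitRingType;
  loc_map : {rmorphism S -> loc_ring};
  loc_unit : forall x, X x -> loc_map x \is a GRing.unit;
  loc_frac : forall q, exists s (t : seq S), (forall x, x \in t -> X x) /\
    q * loc_map (\prod_(x <- t) x) = loc_map s;
  loc_ker : forall s, loc_map s = 0 ->
    exists t : seq S, (forall x, x \in t -> X x) /\ \prod_(x <- t) x * s = 0
}.

Section Demazure.
Variables (D : root_datum) (W : weyl_group D) (R : comNzRingType) (F : fgl R).

Local Notation S := (fgr F 'cV[int]_(rk D)).

Definition x_root (a : ridx D) : S := fgr_x F (root a).

Definition weyl_act (w : W) : S -> S := fgr_map (fun l => weyl_mx w *m l).

(* The ring Q with its action of W, the unique one extending that on S *)
Record wlocalization := WLocalization {
  wloc :> localization (fun s => exists a, s = x_root a);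
  qact : W -> {rmorphism wloc -> wloc};
  qact_map : forall w s, qact w (loc_map wloc s) = loc_map wloc (weyl_act w s)
}.

Variable Q : wlocalization.

Definition qx (a : ridx D) : Q := loc_map Q (x_root a).

(* q belongs to S *)
Definition in_S (q : Q) : Prop := exists s, q = loc_map Q s.

(* q belongs to x_a S *)
Definition x_dvd (a : ridx D) (q : Q) : Prop :=
  exists s, q = qx a * loc_map Q s.

(* z : QW is \sum_w z w delta_w *)
Definition QW := {ffun W -> Q}.

Definition delta (w : W) : QW := [ffun u => (u == w)%:R].

Definition qw_scale (q : Q) (z : QW) : QW := [ffun w => q * z w].

(* The coefficient of delta_u in
   \sum_(v, w) (z v delta_v) (z' w delta_w) is a sum over w = v^-1 u. *)
Definition qw_mul (z z' : QW) : QW :=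
  [ffun u => \sum_v z v * qact Q v (z' (v^-1 * u)%g)].

Definition demazure_elt (a : ridx D) : QW :=
  qw_scale (qx a)^-1 (delta 1%g - delta (srefl W a)).

(* The subring generated by S and the X_a; it is stable under opposites since
   -1 belongs to S. *)
Inductive in_D : QW -> Prop :=
  | in_D_S s : in_D (qw_scale (loc_map Q s) (delta 1%g))
  | in_D_X a : in_D (demazure_elt a)
  | in_D_add z z' : in_D z -> in_D z' -> in_D (z + z')
  | in_D_mul z z' : in_D z -> in_D z' -> in_D (qw_mul z z').

Variables (B : base D) (P : {set ridx D}).

Definition Qquo := {ffun Wquo W B P -> Q}.

Definition qquo_proj (z : QW) : Qquo :=
  [ffun v => \sum_(w | minrep B P w == v) z w].

(* g : Qdual is \sum_w g w f_w *)
Definition Qdual := {ffun Wquo W B P -> Q}.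

Definition fdual (w : Wquo W B P) : Qdual := [ffun v => (v == w)%:R].

Definition qdual_scale (q : Q) (g : Qdual) : Qdual := [ffun v => q * g v].

Definition qeval (g : Qdual) (z : Qquo) : Q := \sum_v g v * z v.

Definition odot (z : QW) (g : Qdual) : Qdual :=
  [ffun u => \sum_w \sum_(v | minrep B P (w * val v)%g == u)
     z w * qact Q w (g v)].

Definition DPdual_pred : {pred Qdual} :=
  fun g => `[< forall z, in_D z -> in_S (qeval g (qquo_proj z)) >].

Fact DPdual_zmod_closed : zmod_closed DPdual_pred.
Proof.
split=> [|g h /asboolP hg /asboolP hh]; apply/asboolP => z Dz.
  exists 0; rewrite rmorph0 /qeval big1 // => v _; by rewrite ffunE mul0r.
have [s Es] := hg z Dz; have [t Et] := hh z Dz; exists (s - t).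
rewrite rmorphB -Es -Et /qeval -sumrB.
by apply: eq_bigr => v _; rewrite !ffunE mulrBl.
Qed.

HB.instance Definition _ :=
  GRing.isZmodClosed.Build _ DPdual_pred DPdual_zmod_closed.

(* D_P^* as an abelian group *)
Record DPdual := MkDPdual { dp_val : Qdual; _ : dp_val \in DPdual_pred }.

HB.instance Definition _ := [isSub for dp_val].
HB.instance Definition _ := [Choice of DPdual by <:].
HB.instance Definition _ := [SubChoice_isSubZmodule of DPdual by <:].

Definition E_Q (phi : {additive Qdual -> Qdual}) : Prop :=
  forall z g, phi (odot z g) = odot z (phi g).

(* D-linearity, stated without using that odot z g is again in D_P^* *)
Definition E_D (psi : {additive DPdual -> DPdual}) : Prop :=
  forall z (g g' : DPdual), in_D z ->
    val g' = odot z (val g) -> val (psi g') = odot z (val (psi g)).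

(* The image of psi in E_Q is its extension of scalars to Q, i.e. the element
   of E_Q that restricts to psi on D_P^*. *)
Definition comes_from_E_D (phi : {additive Qdual -> Qdual}) : Prop :=
  exists psi : {additive DPdual -> DPdual},
    E_D psi /\ forall g : DPdual, phi (val g) = val (psi g).

Definition x_Pi_over_P : Q :=
  (\prod_(a | negative_root B a) qx a) /
  (\prod_(a | levi_root P a && negative_root B a) qx a).

(* The coset of s_(w(a)) w *)
Definition refl_coset (w : Wquo W B P) (a : ridx D) : Wquo W B P :=
  minrep B P (srefl W (wroot (val w) a) * val w)%g.

(* The Calmes-Zainoulline-Zhong criterion for membership in D_P^* *)
Definition CZZ_criterion : Prop :=
  forall g : Qdual, g \in DPdual_pred <->
    (forall w, in_S (g w)) /\
    (forall w a, ~~ levi_root P a ->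
       x_dvd (wroot (val w) a) (g w - g (refl_coset w a))).

End Demazure.

(* Main.v *)
From HB Require Import structures.
From mathcomp Require Import all_boot all_order all_fingroup all_algebra.
From mathcomp Require Import boolp finmap zify.
From mathcomp.multinomials Require Import monalg.
Require Import Defs.

Set Implicit Arguments.
Unset Strict Implicit.
Unset Printing Implicit Defensive.

Import GRing.Theory Num.Theory Order.TTheory.
Local Open Scope ring_scope.
Local Open Scope quotient_scope.

(** Since [pt] = x_{Pi/P} f_1 and phi is Q-linear, phi([pt]) has coefficients
    x_{Pi/P} c_w, so by the criterion the stated condition on the c_w says
    exactly that phi([pt]) lies in D_P^*.  If phi comes from E_D this holds
    because [pt] lies in D_P^*.  Conversely, as D_P^* is the D-module generated
    by [pt], phi(z [pt]) = z phi([pt]) lies in D_P^* for every z in D, so phi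
    restricts to D_P^*.  What has to be proved is therefore that [pt] lies in
    D_P^*, that D acts on D_P^*, and that [pt] generates D_P^*.

    Integrality.  The criterion puts the constant function 1 in D_P^*; pairing
    it with X_a s shows that s - s_a(s) is divisible by x_a in S
    ([divided_difference]).  It follows that x_{-a} is a unit multiple of x_a
    ([qx_opp]), whence [pt] lies in D_P^* ([point_class_DPdual]), and that D
    acts on D_P^*, by the twisted Leibniz rule
      <X_a g, z> = <g, X_a z> + X_a (<g, delta_a z>)
    ([odot_DPdual]).

    Generation.  Order the cosets w W_P by the number len w of positive roots b
    such that w^-1(b) is negative and outside the Levi part, and let e_w be the
    product of the corresponding x_b.  Going up with one X_a at a time yields z
    in D such that the functional <., z> is (unit / e_w) times the value at w on
    all g supported in length at least len w ([leading_functional]); so an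
    element of D_P^* supported there has a value divisible by e_w at every
    coset of minimal length.  Going down from the longest coset yields an
    element of D [pt] supported on w and on longer cosets, with value a unit
    times e_w at w ([leading_element]).  Subtracting multiples of the latter,
    one length at a time, writes any element of D_P^* as an element of D [pt]
    ([DPdual_generated]).

    The two ingredients on the Weyl group are the exchange property, which
    makes minimal representatives unique ([minrep_val]), and the fact that the
    coefficients of a root on simple roots outside P are invariant under W_P
    ([simple_coef_WP]).  The action of W on Q is governed by
    w(x_a) = x_{w(a)}, which holds because the renaming of variables preserves
    the closed ideal of relations ([fgr_mapE]). *)

(** * Renaming the variables of the formal group ring *)

Section RenameMonomial.
Variables (I J : choiceType) (h : I -> J).
Implicit Types m : {cmonom I}.

(** The indexing set can be enlarged, which lets two monomials share one. *)
Lemma cmonom_renameE m (d : {fset I}) : (finsupp m `<=` d)%fset ->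
  cmonom_rename h m =
    \big[mmul/mone]_(i <- d) \big[mmul/mone]_(k < m i) ucm (h i).
Proof.
move=> le_md; rewrite /cmonom_rename (big_fset_incl _ le_md) // => i _.
by rewrite -cmE_eq0 => /eqP ->; rewrite big_ord0.
Qed.

Lemma cmonom_rename1 : cmonom_rename h mone = mone.
Proof. by rewrite /cmonom_rename mdom1 big_seq_fset0. Qed.

Lemma cmonom_renameU i : cmonom_rename h (ucm i) = ucm (h i).
Proof. by rewrite /cmonom_rename mdomU big_seq_fset1 cmUU big_ord1. Qed.

Lemma cmonom_renameM :
  {morph cmonom_rename h : m1 m2 / mmul m1 m2 >-> mmul m1 m2}.
Proof.
move=> m1 m2; rewrite (cmonom_renameE (m := m1) (fsubsetUl _ (finsupp m2))).
rewrite (cmonom_renameE (m := m2) (fsubsetUr (finsupp m1) _)).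
rewrite /cmonom_rename mdomD.
rewrite -big_split /=; apply: eq_bigr => i _.
by rewrite cmM big_split_ord.
Qed.

End RenameMonomial.

Lemma cmonom_rename_comp (I J K : choiceType) (g : J -> K) (h : I -> J) m :
  cmonom_rename g (cmonom_rename h m) = cmonom_rename (g \o h) m.
Proof.
rewrite {1}/cmonom_rename -/(cmonom_rename g _).
transitivity (\big[mmul/mone]_(i <- finsupp m) \big[mmul/mone]_(k < m i)
   cmonom_rename g (ucm (h i))).
  rewrite (big_morph _ (@cmonom_renameM _ _ g) (cmonom_rename1 g)).
  apply: eq_bigr => i _.
  exact: (big_morph _ (@cmonom_renameM _ _ g) (cmonom_rename1 g)).
by apply: eq_bigr => i _; apply: eq_bigr => k _; rewrite cmonom_renameU.
Qed.

Lemma cmonom_rename_id (I : choiceType) (m : {cmonom I}) :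
  cmonom_rename id m = m.
Proof.
apply/eqP/cmP => j; rewrite /cmonom_rename.
rewrite (big_morph (fun m' : {cmonom I} => m' j) (cmM j) (cm1 j)).
transitivity (\sum_(i <- finsupp m) m i * (i == j))%N.
  apply: eq_bigr => i _.
  rewrite (big_morph (fun m' : {cmonom I} => m' j) (cmM j) (cm1 j)).
  under eq_bigr do rewrite cmU.
  by rewrite sum_nat_const card_ord.
have [jm|jNm] := boolP (j \in finsupp m).
  rewrite (big_fsetD1 j) //= eqxx muln1 big1_seq ?addn0 // => i.
  by rewrite in_fsetD1 => /andP[_ /andP[/negPf -> _]]; rewrite muln0.
rewrite big1_seq ?(eqP (etrans (cmE_eq0 m j) jNm)) // => i /andP[_ im].
by have [ij|] := eqVneq i j; rewrite ?muln0 //; rewrite -ij im in jNm.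
Qed.

Section RenameAlgebra.
Variables (R : comNzRingType) (I J : choiceType) (h : I -> J).

Definition rename_monomial (m : {cmonom I}) : {malg R[{cmonom J}]} :=
  << cmonom_rename h m >>.

Fact rename_monomial_mmorphism : mmorphism rename_monomial.
Proof.
rewrite /rename_monomial; split=> [m1 m2|]; last by rewrite cmonom_rename1.
by rewrite cmonom_renameM malgM_def fgmulUU mulr1.
Qed.

HB.instance Definition _ :=
  isMultiplicative.Build _ _ rename_monomial rename_monomial_mmorphism.

Let malgC_mulU (c : R) (k : {cmonom J}) :
  malgC c * << k >> = << c *g k >> :> {malg R[{cmonom J}]}.
Proof. by rewrite malgM_def fgmulUU mul1m mulr1. Qed.

Lemma malg_renameE :
  @malg_rename R I J h =1 mmap (@malgC {cmonom J} R) rename_monomial.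
Proof.
move=> p; apply: eq_bigr => m _; exact/esym/malgC_mulU.
Qed.

Lemma malg_rename0 : malg_rename h (0 : {malg R[{cmonom I}]}) = 0.
Proof. by rewrite malg_renameE raddf0. Qed.

Lemma malg_renameD : {morph @malg_rename R I J h : p q / p + q}.
Proof. by move=> p q; rewrite !malg_renameE raddfD. Qed.

Lemma malg_renameM : {morph @malg_rename R I J h : p q / p * q}.
Proof. by move=> p q; rewrite !malg_renameE rmorphM. Qed.

Lemma malg_rename1 : malg_rename h (1 : {malg R[{cmonom I}]}) = 1.
Proof. by rewrite malg_renameE rmorph1. Qed.

Lemma malg_renameZ c : {morph @malg_rename R I J h : p / c *: p}.
Proof. by move=> p; rewrite !malg_renameE mmapZ mul_malgC. Qed.

Lemma malg_renameU c m :
  malg_rename h (<< c *g m >> : {malg R[{cmonom I}]}) =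
    << c *g cmonom_rename h m >>.
Proof.
rewrite malg_renameE mmapU; exact: malgC_mulU.
Qed.

Lemma mps_eqP (K : choiceType) (f g : mps R K) : (forall d, f d = g d) -> f = g.
Proof. by move=> fg; apply/val_inj/funext. Qed.

Lemma mps_renameD : {morph @mps_rename R I J h : f g / f + g}.
Proof. by move=> f g; apply: mps_eqP => d; exact: malg_renameD. Qed.

Lemma mps_rename0 : mps_rename h (0 : mps R I) = 0.
Proof. by apply: mps_eqP => d; exact: malg_rename0. Qed.

Lemma mps_renameN : {morph @mps_rename R I J h : f / - f}.
Proof.
move=> f; apply/eqP.
by rewrite -addr_eq0 -mps_renameD addNr mps_rename0.
Qed.

Lemma mps_renameM : {morph @mps_rename R I J h : f g / f * g}.
Proof.
move=> f g; apply: mps_eqP => d.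
rewrite [LHS](big_morph _ malg_renameD malg_rename0).
by apply: eq_bigr => i _; exact: malg_renameM.
Qed.

Lemma mps_rename1 : mps_rename h (1 : mps R I) = 1.
Proof.
apply: mps_eqP => -[|d] /=; first exact: malg_rename1.
exact: malg_rename0.
Qed.

Lemma mps_renameX n : {morph @mps_rename R I J h : f / f ^+ n}.
Proof.
move=> f; elim: n => [|n IHn]; first by rewrite mps_rename1.
by rewrite !exprS mps_renameM IHn.
Qed.

Lemma mps_rename_var i : mps_rename h (mps_var R i) = mps_var R (h i).
Proof.
apply: mps_eqP => d /=; case: eqP => _; last exact: malg_rename0.
by rewrite malg_renameU cmonom_renameU.
Qed.

Lemma mps_rename_eval2 (a : nat -> nat -> R) (p q : mps R I) :
  mps_rename h (mps_eval2 a p q) =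
    mps_eval2 a (mps_rename h p) (mps_rename h q).
Proof.
apply: mps_eqP => d.
rewrite [LHS](big_morph _ malg_renameD malg_rename0); apply: eq_bigr => i _.
rewrite (big_morph _ malg_renameD malg_rename0); apply: eq_bigr => j _.
by rewrite malg_renameZ -!mps_renameX -mps_renameM.
Qed.

End RenameAlgebra.

Lemma mps_rename_comp (R : comNzRingType) (I J K : choiceType)
    (g : J -> K) (h : I -> J) (f : mps R I) :
  mps_rename g (mps_rename h f) = mps_rename (g \o h) f.
Proof.
apply: mps_eqP => d; rewrite /= /malg_rename -!/(malg_rename _ _).
rewrite (big_morph _ (@malg_renameD R _ _ g) (malg_rename0 R g)).
by apply: eq_bigr => m _; rewrite malg_renameU cmonom_rename_comp.
Qed.

Lemma mps_rename_id (R : comNzRingType) (I : choiceType) (f : mps R I) :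
  mps_rename id f = f.
Proof.
apply: mps_eqP => d; rewrite /= [RHS]monalgE; apply: eq_bigr => m _.
by rewrite cmonom_rename_id.
Qed.

Section FormalGroupMap.
Variables (R : comNzRingType) (F : fgl R) (M : zmodType).
Implicit Types (h : M -> M) (f : mps R M).

Local Notation pi := (\pi_{ideal_quot (@fgr_ideal R F M)}).

Lemma fgr_pi_eq f g : pi f = pi g <-> f - g \in fgr_ideal F (M := M).
Proof. by split=> [/eqP|?]; last apply/eqP; rewrite -Quotient.idealrBE. Qed.

(** The series whose renaming lies in the ideal of relations form a closed
    ideal that contains the relations, as an additive h maps relations to
    relations. Hence the choice of a representative does not matter. *)
Lemma fgr_mapE h : {morph h : a b / a + b} ->
  forall f, fgr_map h (pi f : fgr F M) = pi (mps_rename h f).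
Proof.
move=> hD f.
have h0 : h 0 = 0 by apply: (addrI (h 0)); rewrite -hD !addr0.
rewrite /fgr_map; apply/fgr_pi_eq.
rewrite -mps_renameN -mps_renameD.
have : generic_quotient.repr (pi f) - f \in fgr_ideal F (M := M).
  by apply/fgr_pi_eq; rewrite generic_quotient.reprK.
move: (_ - f) => {}f /asboolP If.
apply/asboolP => E idE clE relE.
apply: (If (fun f => E (mps_rename h f))).
- case: idE => E0 ED EM; split; first by rewrite mps_rename0.
    by move=> f1 f2 *; rewrite mps_renameD; exact: ED.
  by move=> f1 f2 *; rewrite mps_renameM; exact: EM.
- move=> f1 Hf1; apply: clE => n; have [g Eg fg] := Hf1 n.
  exists (mps_rename h g); first exact: Eg.
  by move=> d lt_dn; exact: (congr1 (malg_rename h) (fg d lt_dn)).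
- move=> _ [->|[a [b ->]]]; apply: relE.
    by left; rewrite mps_rename_var h0.
  right; exists (h a), (h b).
  by rewrite mps_renameD mps_renameN mps_rename_eval2 !mps_rename_var hD.
Qed.

Lemma fgr_map_x h (hD : {morph h : a b / a + b}) a :
  fgr_map h (fgr_x F a) = fgr_x F (h a).
Proof. by rewrite /fgr_x fgr_mapE // mps_rename_var. Qed.

Lemma fgr_map_comp g h (s : fgr F M) :
    {morph g : a b / a + b} -> {morph h : a b / a + b} ->
  fgr_map g (fgr_map h s) = fgr_map (g \o h) s.
Proof.
by move=> gD hD; rewrite [fgr_map h s]/fgr_map fgr_mapE // mps_rename_comp.
Qed.

Lemma fgr_map_id (s : fgr F M) : fgr_map id s = s.
Proof. by rewrite /fgr_map mps_rename_id generic_quotient.reprK. Qed.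

End FormalGroupMap.

(** * Reflections and the invariant form *)

Section WeylAction.
Variables (D : root_datum) (W : weyl_group D).
Implicit Types (a b c : ridx D) (u v w : W).

Lemma wrootE w a : root (wroot w a) = weyl_mx w *m root a.
Proof. exact/eqP/(xchooseP (wroot_subproof w a)). Qed.

Lemma wrootM u v a : wroot (u * v)%g a = wroot u (wroot v a).
Proof. by apply: root_inj; rewrite !wrootE weyl_mxM mulmxA. Qed.

Lemma wroot1 a : wroot (1%g : W) a = a.
Proof. by apply: root_inj; rewrite wrootE weyl_mx1 mul1mx. Qed.

Lemma wrootK w : cancel (wroot w) (wroot w^-1%g).
Proof. by move=> a; rewrite -wrootM mulVg wroot1. Qed.

Lemma wrootVK w : cancel (wroot w^-1%g) (wroot w).
Proof. by move=> a; rewrite -wrootM mulgV wroot1. Qed.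

(* <a^vee, b> *)
Definition pairing a b : int := (coroot a *m root b) 0 0.

Lemma root_srefl a b :
  root (wroot (srefl W a) b) = root b - root a *~ pairing a b.
Proof.
rewrite wrootE srefl_mx /reflection_mx mulmxBl mul1mx -mulmxA.
rewrite (mx11_scalar (coroot a *m root b)) mul_mx_scalar.
by rewrite -[X in X *: _]intz scaler_int.
Qed.

Definition opp_root a : ridx D := wroot (srefl W a) a.

Lemma root_opp a : root (opp_root a) = - root a.
Proof.
rewrite /opp_root root_srefl /pairing root_pairing.
by rewrite -[2]/(1 + 1) mulrzDr mulr1z opprD addrA subrr add0r.
Qed.

Lemma opp_rootK : involutive opp_root.
Proof. by move=> a; apply: root_inj; rewrite !root_opp opprK. Qed.

Lemma wroot_opp w a : wroot w (opp_root a) = opp_root (wroot w a).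
Proof. by apply: root_inj; rewrite wrootE !root_opp wrootE mulmxN. Qed.

Lemma srefl2 a : (srefl W a * srefl W a = 1)%g.
Proof.
apply: weyl_mx_inj; rewrite weyl_mxM weyl_mx1 !srefl_mx /reflection_mx.
rewrite mulmxBr mulmx1 mulmxBl mul1mx -mulmxA (mulmxA (coroot a)).
rewrite (mx11_scalar (coroot a *m root a)) root_pairing mul_scalar_mx.
by rewrite -[2]/(1 + 1) scalerDl scale1r mulmxDr opprB addrK subrK.
Qed.

Lemma sreflV a : ((srefl W a)^-1 = srefl W a)%g.
Proof. by apply/eqP; rewrite eq_invg_mul srefl2. Qed.

Lemma gen_srefl_ind (A : {pred ridx D}) (K : W -> Prop) :
    K 1%g -> (forall a w, a \in A -> K w -> K (srefl W a * w)%g) ->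
  forall w, w \in <<[set srefl W a | a in A]>>%g -> K w.
Proof.
move=> K1 KM w /gen_prodgP[n [s sA ->]].
elim: n s sA => [|n IHn] s sA; first by rewrite big_ord0.
rewrite big_ord_recl; have /imsetP[a aA ->] := sA ord0.
by apply: KM => //; apply: IHn => i; apply: sA.
Qed.

Lemma weyl_ind (K : W -> Prop) :
  K 1%g -> (forall a w, K w -> K (srefl W a * w)%g) -> forall w, K w.
Proof.
move=> K1 KM w; apply: (gen_srefl_ind (A := predT)) => // [a v _|].
  exact: KM.
by rewrite weyl_gen inE.
Qed.

(** The sum runs over all coroots, which the Weyl group permutes: the form is
    W-invariant by construction, and positive on roots. *)
Definition wform (x y : 'cV[int]_(rk D)) : int :=
  \sum_a (coroot a *m x) 0 0 * (coroot a *m y) 0 0.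

Lemma wform_inv w x y : wform (weyl_mx w *m x) (weyl_mx w *m y) = wform x y.
Proof.
elim/weyl_ind: w => [|a w IHw]; first by rewrite weyl_mx1 !mul1mx.
rewrite weyl_mxM -!mulmxA; rewrite -[RHS]IHw.
move: (weyl_mx w *m x) (weyl_mx w *m y) => {IHw}x {}y.
have Ex b : exists c, coroot c == coroot b *m weyl_mx (srefl W a).
  have [c Ec] := coroot_refl a b; exists c.
  by rewrite srefl_mx Ec /reflection_mx mulmxBr mulmx1 mulmxA.
pose h b := xchoose (Ex b).
have hE b : coroot (h b) = coroot b *m weyl_mx (srefl W a).
  exact/eqP/(xchooseP (Ex b)).
have h_inv b : h (h b) = b.
  by apply: coroot_inj; rewrite !hE -mulmxA -weyl_mxM srefl2 weyl_mx1 mulmx1.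
(* h is the permutation of the coroots induced by s_a. *)
rewrite [RHS](reindex_inj (can_inj h_inv)).
by apply: eq_bigr => b _; rewrite hE !mulmxA.
Qed.

Lemma wform_root_gt0 a : 0 < wform (root a) (root a).
Proof.
rewrite /wform (bigD1 a) //= root_pairing.
by apply: ltr_pwDl => //; apply: sumr_ge0 => b _; exact: sqr_ge0.
Qed.

Lemma wformC x y : wform x y = wform y x.
Proof. by apply: eq_bigr => a _; rewrite mulrC. Qed.

Lemma wformDl x y z : wform (x + y) z = wform x z + wform y z.
Proof.
rewrite /wform -big_split; apply: eq_bigr => a _ /=.
by rewrite mulmxDr mxE mulrDl.
Qed.

Lemma wformNl x y : wform (- x) y = - wform x y.
Proof.
rewrite /wform -sumrN; apply: eq_bigr => a _ /=.
by rewrite mulmxN mxE mulNr.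
Qed.

Lemma wformZl (k : int) x y : wform (k *: x) y = k * wform x y.
Proof.
rewrite /wform mulr_sumr; apply: eq_bigr => a _ /=.
by rewrite -scalemxAr mxE mulrA.
Qed.

(** Compare the values of the invariant form on (x, a) and (s_a x, s_a a),
    where s_a a = - a. The form thus determines each coroot from its root,
    which identifies the coroot of w(a). *)
Lemma pairing_wform a x :
  (coroot a *m x) 0 0 * wform (root a) (root a) = wform x (root a) *+ 2.
Proof.
set k := (coroot a *m x) 0 0.
have := wform_inv (srefl W a) x (root a).
rewrite -wrootE -/(opp_root a) root_opp srefl_mx /reflection_mx.
rewrite mulmxBl mul1mx -mulmxA (mx11_scalar (coroot a *m x)) mul_mx_scalar -/k.
rewrite wformC wformNl wformC wformDl wformNl wformZl => /eqP.
by rewrite opprD opprK addrC subr_eq mulr2n => /eqP.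
Qed.

(** The axioms on reflections of roots and on reflections of coroots do not
    say that they induce the same permutation of the index set; the invariant
    form shows that they do. *)
Lemma coroot_wroot w a : coroot (wroot w a) *m weyl_mx w = coroot a.
Proof.
apply/rowP => i.
have E (x : 'cV[int]_(rk D)) :
    (coroot (wroot w a) *m weyl_mx w *m x) 0 0 = (coroot a *m x) 0 0.
  have /lt0r_neq0 nz := wform_root_gt0 a.
  apply: (mulIf nz); rewrite pairing_wform -(wform_inv w x) -wrootE.
  by rewrite -pairing_wform wrootE wform_inv -mulmxA.
by have := E (delta_mx i 0); rewrite -!colE ![col _ _ _ _]mxE.
Qed.

Lemma srefl_wroot w a : srefl W (wroot w a) = (w * srefl W a * w^-1)%g.
Proof.
apply: (canRL (mulgK w)); apply: weyl_mx_inj.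
rewrite !weyl_mxM !srefl_mx /reflection_mx mulmxBl mul1mx mulmxBr mulmx1.
by rewrite -mulmxA coroot_wroot wrootE mulmxA.
Qed.

(** Both pairings have the sign of the invariant form on (a, b). *)
Lemma pairing_gt0C a b : 0 < pairing a b -> 0 < pairing b a.
Proof.
move=> ab; rewrite -(pmulr_lgt0 _ (wform_root_gt0 b)) pairing_wform.
by rewrite wformC -pairing_wform pmulr_lgt0 // wform_root_gt0.
Qed.

End WeylAction.

(** * Positive roots, words and the exchange property *)

Section Positivity.
Variables (D : root_datum) (W : weyl_group D) (B : base D).
Implicit Types (a b c : ridx D) (u v w : W).

Local Notation Delta := (simple B).
Local Notation s_ := (srefl W).

Fact simple_coef_subproof a : exists k : ridx D -> int,
  root a = \sum_(b in Delta) root b *~ k b /\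
  ((forall b, 0 <= k b) \/ (forall b, k b <= 0)).
Proof.
have [k [E|E]] := simple_span B a.
  by exists (fun b => (k b)%:Z); split=> //; left.
exists (fun b => - (k b)%:Z); split; last by right=> b; rewrite oppr_le0.
by rewrite E -sumrN; apply: eq_bigr => b _; rewrite mulrNz.
Qed.

(** Extended by 0 outside the base, so that sums and sign conditions need not
    mention membership in the base. *)
Definition simple_coef a b : int :=
  if b \in Delta then projT1 (cid (simple_coef_subproof a)) b else 0.

Local Notation cf := simple_coef.

Lemma simple_coefE a : root a = \sum_(b in Delta) root b *~ cf a b.
Proof.
rewrite /simple_coef; case: cid => k [/= -> _].
by apply: eq_bigr => b ->.
Qed.

Lemma simple_coef_out a b : b \notin Delta -> cf a b = 0.
Proof. by rewrite /simple_coef => /negPf ->. Qed.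

Lemma simple_coef_sign a : (forall b, 0 <= cf a b) \/ (forall b, cf a b <= 0).
Proof.
rewrite /simple_coef; case: cid => k [/= _ [k0|k0]]; [left|right] => b;
  by case: ifP.
Qed.

Lemma simple_coef_uniq a (k : ridx D -> int) :
    root a = \sum_(b in Delta) root b *~ k b ->
  forall b, b \in Delta -> cf a b = k b.
Proof.
move=> Ea b bD; apply/eqP; rewrite -subr_eq0; apply/eqP.
apply: (simple_free (k := fun b => cf a b - k b) _ bD).
under eq_bigr do rewrite mulrzBr.
by rewrite sumrB -simple_coefE Ea subrr.
Qed.

Lemma simple_coef_opp a b : cf (opp_root W a) b = - cf a b.
Proof.
have [bD|bD] := boolP (b \in Delta); last by rewrite !simple_coef_out // oppr0.
apply: (simple_coef_uniq (k := fun b => - cf a b)) => //.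
rewrite root_opp simple_coefE -sumrN.
by apply: eq_bigr => c _; rewrite mulrNz.
Qed.

Lemma simple_coef_srefl a c b :
  cf (wroot (s_ a) c) b = cf c b - cf a b * pairing a c.
Proof.
have [bD|bD] := boolP (b \in Delta); last first.
  by rewrite !simple_coef_out // mul0r subr0.
apply: (simple_coef_uniq (k := fun b => cf c b - cf a b * pairing a c)) => //.
rewrite root_srefl {1}(simple_coefE c) {1}(simple_coefE a).
rewrite mulrz_suml -sumrB; apply: eq_bigr => d _.
by rewrite mulrzBr mulrzA.
Qed.

Lemma simple_coef_simple a b : a \in Delta -> cf a b = (a == b)%:R.
Proof.
move=> aD; have [bD|bD] := boolP (b \in Delta); last first.
  rewrite simple_coef_out //; case: eqVneq => // ab.
  by rewrite -ab aD in bD.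
apply: (simple_coef_uniq (k := fun b => (a == b)%:R)) => //.
rewrite (bigD1 a) //= eqxx mulr1z big1 ?addr0 // => c /andP[_ /negPf].
by rewrite eq_sym => ->; rewrite mulr0z.
Qed.

Lemma simple_coef_wroot w a b :
  cf (wroot w a) b = \sum_(c in Delta) cf a c * cf (wroot w c) b.
Proof.
have [bD|bD] := boolP (b \in Delta); last first.
  rewrite simple_coef_out // big1 // => c _.
  by rewrite (simple_coef_out _ bD) mulr0.
apply: (simple_coef_uniq
  (k := fun b => \sum_(c in Delta) cf a c * cf (wroot w c) b)) => //.
rewrite wrootE simple_coefE mulmx_sumr.
under [RHS]eq_bigr do rewrite mulrz_sumr.
rewrite exchange_big; apply: eq_bigr => c cD /=.
transitivity (root (wroot w c) *~ cf a c).
  by rewrite wrootE; exact: (raddfMz (mulmx (weyl_mx w))).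
rewrite {1}simple_coefE mulrz_suml; apply: eq_bigr => d _.
by rewrite -mulrzA mulrC.
Qed.

Lemma simple_coef_neq0 a : exists b, cf a b != 0.
Proof.
apply/existsP; apply: contraT => /existsPn h.
have := root_pairing a; rewrite simple_coefE big1 ?mulmx0 ?mxE // => b _.
by move: (h b); rewrite negbK => /eqP ->; rewrite mulr0z.
Qed.

Definition pos_root a := [forall b, 0 <= cf a b].

Local Notation pos := pos_root.

Lemma pos_rootP a : reflect (forall b, 0 <= cf a b) (pos a).
Proof. exact: forallP. Qed.

Lemma neg_rootP a : reflect (forall b, cf a b <= 0) (~~ pos a).
Proof.
apply: (iffP idP) => [|h].
  by case: (simple_coef_sign a) => // h /negP[]; apply/pos_rootP.
apply/pos_rootP => h'; have [b /eqP[]] := simple_coef_neq0 a.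
by apply/eqP; rewrite eq_le h h'.
Qed.

Lemma pos_root_gt0 a b : 0 < cf a b -> pos a.
Proof.
by move=> ab; apply: contraLR ab => /neg_rootP/(_ b); rewrite -leNgt.
Qed.

Lemma pos_opp a : pos (opp_root W a) = ~~ pos a.
Proof.
apply/pos_rootP/neg_rootP => h b; first by rewrite -oppr_ge0 -simple_coef_opp.
by rewrite simple_coef_opp oppr_ge0.
Qed.

Lemma simple_pos a : a \in Delta -> pos a.
Proof. by move=> aD; apply/pos_rootP => b; rewrite simple_coef_simple. Qed.

(** As the root system is reduced, c has a positive coefficient at some simple
    root other than a, and s_a does not change that coefficient. *)
Lemma pos_srefl a c :
  a \in Delta -> pos c -> c != a -> pos (wroot (s_ a) c).
Proof.
move=> aD /pos_rootP c0 nca.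
have [/existsP[b /andP[nab cb]]|/existsPn h] :=
  boolP [exists b, (a != b) && (cf c b != 0)].
  apply: (@pos_root_gt0 _ b).
  rewrite simple_coef_srefl (simple_coef_simple b aD) (negPf nab).
  by rewrite mul0r subr0 lt0r cb c0.
have Ec : root c = root a *~ cf c a.
  rewrite simple_coefE (bigD1 a) //= big1 ?addr0 // => b /andP[_ nba].
  by move: (h b); rewrite eq_sym nba negbK => /eqP ->; rewrite mulr0z.
case: (@root_reduced _ a c 1 (cf c a)) => // [E|E].
  by case/eqP: nca; apply: root_inj.
have := c0 a; suff -> : c = opp_root W a.
  by rewrite simple_coef_opp simple_coef_simple // eqxx.
by apply: root_inj; rewrite root_opp.
Qed.

Definition height a : nat := absz (\sum_(b in Delta) cf a b).

Lemma pairing_sum b a : pairing b a = \sum_(c in Delta) cf a c * pairing b c.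
Proof.
rewrite /pairing {1}simple_coefE mulmx_sumr summxE; apply: eq_bigr => c _.
have -> : root c *~ cf a c = cf a c *: root c.
  by rewrite -[X in X *: _]intz scaler_int.
by rewrite -scalemxAr mxE.
Qed.

Lemma srefl_opp_root a : s_ (opp_root W a) = s_ a.
Proof. by rewrite /opp_root srefl_wroot mulgK. Qed.

(** Induction on the height: a positive root a that is not simple pairs
    positively with some simple root c, since <a, a> = 2 is a nonnegative
    combination of the pairings with simple roots; then s_c(a) is positive, of
    smaller height, and its reflection is conjugate to s_a by s_c. *)
Lemma srefl_simple_gen a : s_ a \in <<[set s_ c | c in Delta]>>%g.
Proof.
wlog pa : a / pos a => [IH|].
  have [|na] := boolP (pos a); first exact: IH.
  by rewrite -srefl_opp_root IH // pos_opp.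
have [n] := ubnP (height a); elim: n a pa => // n IHn a pa han.
have [aD|aND] := boolP (a \in Delta); first exact/mem_gen/imset_f.
have [c cD] : exists2 c, c \in Delta & 0 < pairing c a.
  apply/exists_inP; apply: contraT => /exists_inPn h.
  have := root_pairing a; rewrite -/(pairing a a) pairing_sum => E.
  suff : \sum_(c in Delta) cf a c * pairing a c <= 0 by rewrite E lern0.
  apply: sumr_le0 => c cD; have := h c cD.
  rewrite -leNgt => ca; rewrite mulr_ge0_le0 ?(pos_rootP _ pa) // leNgt.
  by apply: contraL ca => /(pairing_gt0C W); rewrite -ltNge.
move=> ca.
have nac : a != c by apply: contraNneq aND => ->.
have pb := pos_srefl cD pa nac.
have hb : (height (wroot (s_ c) a) < n)%N.
  have hsum : \sum_(b in Delta) cf (wroot (s_ c) a) b =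
      \sum_(b in Delta) cf a b - pairing c a.
    under eq_bigr do rewrite simple_coef_srefl.
    rewrite sumrB; congr (_ - _); rewrite -mulr_suml (bigD1 c) //=.
    rewrite simple_coef_simple // eqxx big1 ?addr0 ?mul1r // => b /andP[_ bc].
    by rewrite simple_coef_simple // eq_sym (negPf bc).
  have : 0 <= \sum_(b in Delta) cf (wroot (s_ c) a) b.
    by apply: sumr_ge0 => b _; exact/pos_rootP.
  by move: han; rewrite /height hsum; lia.
have -> : a = wroot (s_ c) (wroot (s_ c) a).
  by rewrite -wrootM srefl2 wroot1.
have cG : s_ c \in <<[set s_ c | c in Delta]>>%g by exact/mem_gen/imset_f.
by rewrite srefl_wroot !groupM ?groupV //; exact: IHn.
Qed.

Lemma simple_gen : <<[set s_ c | c in Delta]>>%g = [set: W].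
Proof.
apply/eqP; rewrite eqEsubset subsetT -(weyl_gen W) gen_subG /=.
by apply/subsetP => _ /imsetP[a _ ->]; exact: srefl_simple_gen.
Qed.

Definition weyl_word (s : seq (ridx D)) : W := (\prod_(a <- s) s_ a)%g.

Local Notation wd := weyl_word.

Lemma weyl_word_cat s t : wd (s ++ t) = (wd s * wd t)%g.
Proof. by rewrite /weyl_word big_cat. Qed.

Lemma weyl_word_cons a s : wd (a :: s) = (s_ a * wd s)%g.
Proof. by rewrite /weyl_word big_cons. Qed.

Definition simple_word (s : seq (ridx D)) := all [in Delta] s.

(** Applying the letters of s to c from the right, the root becomes negative
    at some letter a, which must then be the root reached so far; s_a is
    therefore a conjugate of s_c, and the letter cancels against the final
    s_c. *)
Lemma exchange s c :
    simple_word s -> c \in Delta -> ~~ pos (wroot (wd s) c) ->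
  exists t, [/\ simple_word t, (size t).+1 = size s &
                wd s * s_ c = wd t]%g.
Proof.
move=> + cD; elim: s => [_|a s IHs /andP[aD sD]].
  by rewrite /weyl_word big_nil wroot1 simple_pos.
rewrite weyl_word_cons wrootM => neg.
have [psc|/IHs] := boolP (pos (wroot (wd s) c)); last first.
  case=> // t [tD st E]; exists (a :: t); rewrite /= st -mulgA E weyl_word_cons.
  by split=> //; apply/andP.
have Ea : wroot (wd s) c = a.
  by apply/eqP; apply: contraNT neg; exact: pos_srefl.
exists s; split=> //.
by rewrite -Ea srefl_wroot mulgKV -mulgA srefl2 mulg1.
Qed.

Lemma weyl_wordP k w :
  reflect (exists s, [/\ simple_word s, size s = k & w = wd s])
          (w \in [set s_ c | c in Delta] ^+ k)%g.
Proof.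
elim: k w => [|k IHk] w.
  rewrite expg0 inE; apply: (iffP eqP) => [->|[s [_ /size0nil -> ->]]].
    by exists [::]; rewrite /weyl_word big_nil.
  by rewrite /weyl_word big_nil.
rewrite expgS; apply: (iffP mulsgP) => [[_ v /imsetP[a aD ->] /IHk]|].
  case=> s [sD sk -> ->]; exists (a :: s); rewrite weyl_word_cons /= sk.
  by split=> //; apply/andP.
case=> -[|a s] [] // /andP[aD sD] [sk] ->; rewrite weyl_word_cons.
exists (s_ a) (wd s) => //; first exact: imset_f.
by apply/IHk; exists s.
Qed.

Lemma weyl_length_le s : simple_word s -> (weyl_length B (wd s) <= size s)%N.
Proof.
move=> sD; rewrite /weyl_length; set p := (X in find X _).
have ps : p (size s) by apply/weyl_wordP; exists s.
have [lt_sW|le_Ws] := ltnP (size s) #|W|; last first.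
  by rewrite (leq_trans (find_size _ _)) // size_iota.
rewrite leqNgt; apply/negP => /(before_find 0%N).
by rewrite nth_iota // add0n ps.
Qed.

(** The length is defined by a search below #|W|, so one must know that a
    shortest word has fewer letters than W has elements: its prefixes
    represent distinct elements, as otherwise the word could be shortened. *)
Lemma reduced_word w :
  exists s, [/\ simple_word s, size s = weyl_length B w & w = wd s].
Proof.
have exP : exists k, w \in ([set s_ c | c in Delta] ^+ k)%g.
  suff [s [sD ws]] : exists s, simple_word s /\ w = wd s.
    by exists (size s); apply/weyl_wordP; exists s.
  have: w \in <<[set s_ c | c in Delta]>>%g by rewrite simple_gen inE.
  elim/gen_srefl_ind => {w} [|a w aD [s [sD ->]]].
    by exists [::]; rewrite /weyl_word big_nil.
  by exists (a :: s); rewrite weyl_word_cons /= aD.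
case: (ex_minnP exP) => k /weyl_wordP[s [sD sk ws]] min_k.
have lt_kW : (k < #|W|)%N.
  pose f (i : 'I_k.+1) := wd (take i s).
  suff /leq_card : injective f by rewrite card_ord.
  suff lt_f (i j : 'I_k.+1) : (i < j)%N -> f i != f j.
    move=> i j Eij; apply: val_inj; apply/eqP.
    by case: ltngtP => // /lt_f; rewrite Eij eqxx.
  move=> lt_ij; apply/eqP => Eij.
  have le_jk : (j <= k)%N by rewrite -ltnS.
  suff /min_k : w \in ([set s_ c | c in Delta] ^+ (i + (k - j)))%g by lia.
  apply/weyl_wordP; exists (take i s ++ drop j s); split.
  - rewrite /simple_word all_cat; have := sD; rewrite -{1}(cat_take_drop i s).
    rewrite /simple_word all_cat => /andP[-> _] /=.
    by apply/allP => x /mem_drop; apply: (allP sD).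
  - rewrite size_cat size_drop size_takel sk //; lia.
  - rewrite weyl_word_cat -/(f i) Eij /f -weyl_word_cat cat_take_drop //.
have /(nth_find 0%N) : has (fun k => w \in [set s_ a | a in Delta] ^+ k)%g
    (iota 0 #|W|).
  apply/hasP; exists k; first by rewrite mem_iota.
  by apply/weyl_wordP; exists s.
rewrite -/(weyl_length B w) nth_iota; last first.
  rewrite ws; apply: leq_ltn_trans (weyl_length_le sD) _.
  by rewrite sk.
by rewrite add0n => /weyl_wordP.
Qed.

(** A nonempty reduced word sends its last letter to a negative root. *)
Lemma pos_simple_eq1 w : (forall c, c \in Delta -> pos (wroot w c)) -> w = 1%g.
Proof.
have [s [+ + Ew]] := reduced_word w.
case/lastP: s Ew => [|s c] Ew sD sk h; first by rewrite Ew /weyl_word big_nil.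
move: sD; rewrite /simple_word all_rcons => /andP[cD sD].
have E : wd (rcons s c) = (wd s * s_ c)%g.
  by rewrite -cats1 weyl_word_cat /weyl_word big_seq1.
have := h c cD; rewrite Ew E wrootM -/(opp_root W c) wroot_opp pos_opp.
case/(exchange sD cD) => t [tD st Et].
have := weyl_length_le tD.
by rewrite -Et -E -Ew -sk size_rcons -st ltnNge leqnSn.
Qed.

Lemma negative_rootE a : negative_root B a = ~~ pos a.
Proof.
apply/asboolP/neg_rootP => [[k Ea] b|h].
  have [bD|bD] := boolP (b \in Delta); last by rewrite simple_coef_out.
  rewrite (simple_coef_uniq (k := fun b => - (k b)%:Z)) ?oppr_le0 //.
  by rewrite Ea -sumrN; apply: eq_bigr => c _; rewrite mulrNz.
exists (fun b => absz (cf a b)); rewrite {1}(simple_coefE a) -sumrN.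
apply: eq_bigr => b _; rewrite -[X in X = _]opprK -mulrNz; congr (- _).
by rewrite pmulrn; congr (_ *~ _); have := h b; lia.
Qed.

End Positivity.

(** * The parabolic subgroup and minimal representatives *)

Section Parabolic.
Variables (D : root_datum) (W : weyl_group D) (B : base D) (P : {set ridx D}).
Hypothesis P_simple : P \subset simple B.
Implicit Types (a b c : ridx D) (u v w : W).

Local Notation Delta := (simple B).
Local Notation s_ := (srefl W).
Local Notation cf := (simple_coef B).
Local Notation pos := (pos_root B).
Local Notation WP := (WP_group W P).

Lemma levi_rootP a :
  reflect (forall b, b \notin P -> cf a b = 0) (levi_root P a).
Proof.
apply: (iffP (asboolP _)) => [[k Ea] b bP|h].
  have [bD|bD] := boolP (b \in Delta); last by rewrite simple_coef_out.
  rewrite (simple_coef_uniq (k := fun b => if b \in P then k b else 0)) //.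
    by rewrite (negPf bP).
  rewrite Ea [RHS](big_setID P) /= (setIidPr P_simple) [X in _ + X]big1 ?addr0.
    by apply: eq_bigr => c ->.
  by move=> c /setDP[_ /negPf ->]; rewrite mulr0z.
exists (cf a); rewrite {1}(simple_coefE B a) (big_setID P) /=.
rewrite (setIidPr P_simple) [X in _ + X]big1 ?addr0 //.
by move=> c /setDP[_ /h ->]; rewrite mulr0z.
Qed.

(** These are the roots in the unipotent radical of P and of its opposite.  A
    coefficient of given sign at one simple root outside P is all it takes, and
    this form makes the invariance under W_P apparent. *)
Definition out_pos a := [exists b, (b \notin P) && (0 < cf a b)].
Definition out_neg a := [exists b, (b \notin P) && (cf a b < 0)].

Lemma out_posE a : out_pos a = pos a && ~~ levi_root P a.
Proof.
apply/existsP/andP => [[b /andP[bP ab]]|[/pos_rootP pa]].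
  split; first exact: pos_root_gt0 ab.
  by apply: contraL ab => /levi_rootP ->.
move=> la; apply/existsP; apply: contraR la => /existsPn h.
apply/levi_rootP => b bP; apply/eqP; rewrite eq_le pa andbT.
by have := h b; rewrite bP -leNgt.
Qed.

Lemma out_pos_opp a : out_pos (opp_root W a) = out_neg a.
Proof.
by apply: eq_existsb => b; rewrite simple_coef_opp oppr_gt0.
Qed.

Lemma out_neg_opp a : out_neg (opp_root W a) = out_pos a.
Proof.
by apply: eq_existsb => b; rewrite simple_coef_opp oppr_lt0.
Qed.

Lemma levi_root_opp a : levi_root P (opp_root W a) = levi_root P a.
Proof.
apply/levi_rootP/levi_rootP => h b bP; apply: oppr_inj; rewrite oppr0.
  by rewrite -(simple_coef_opp W) h.
by rewrite simple_coef_opp opprK h.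
Qed.

Lemma out_negE a : out_neg a = ~~ pos a && ~~ levi_root P a.
Proof. by rewrite -out_pos_opp out_posE pos_opp levi_root_opp. Qed.

(** The reflection in an element of P only adds a multiple of that element. *)
Lemma simple_coef_WP u a b :
  u \in WP -> b \notin P -> cf (wroot u a) b = cf a b.
Proof.
move=> + bP; elim/gen_srefl_ind => {u} [|c u cP IHu]; first by rewrite wroot1.
rewrite wrootM simple_coef_srefl IHu.
rewrite (simple_coef_simple b (subsetP P_simple c cP)).
have [cb|_] := eqVneq c b; last by rewrite mul0r subr0.
by rewrite -cb cP in bP.
Qed.

Lemma out_neg_WP u a : u \in WP -> out_neg (wroot u a) = out_neg a.
Proof.
move=> uP; apply: eq_existsb => b.
by case: (boolP (b \in P)) => //= bP; rewrite simple_coef_WP.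
Qed.

Lemma levi_root_WP u a : u \in WP -> levi_root P (wroot u a) = levi_root P a.
Proof.
move=> uP; apply/levi_rootP/levi_rootP => h b bP.
  by rewrite -(simple_coef_WP a uP) ?h.
by rewrite simple_coef_WP ?h.
Qed.

(** The coefficient of w(b) at a simple root is a nonnegative combination of
    the coefficients of the w(a), a simple. *)
Lemma simple_out_pos w b :
  pos b -> out_pos (wroot w b) -> exists2 a, a \in Delta & out_pos (wroot w a).
Proof.
move=> /pos_rootP pb /existsP[c /andP[cP]]; rewrite simple_coef_wroot => gt0.
apply/exists_inP; apply: contraTT gt0 => /exists_inPn h.
rewrite -leNgt; apply: sumr_le0 => a aD; apply: mulr_ge0_le0 => //.
rewrite leNgt; apply: contra (h a aD) => ac.
by apply/existsP; exists c; rewrite cP.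
Qed.

Lemma simple_out_neg w b :
  pos b -> out_neg (wroot w b) -> exists2 a, a \in Delta & out_neg (wroot w a).
Proof.
move=> /pos_rootP pb /existsP[c /andP[cP]]; rewrite simple_coef_wroot => lt0.
apply/exists_inP; apply: contraTT lt0 => /exists_inPn h.
rewrite -leNgt; apply: sumr_ge0 => a aD; apply: mulr_ge0 => //.
rewrite leNgt; apply: contra (h a aD) => ac.
by apply/existsP; exists c; rewrite cP.
Qed.

Lemma minrep_pos w a : w \in minreps W B P -> a \in P -> pos (wroot w a).
Proof.
rewrite inE => /forall_inP min_w aP.
have aD := subsetP P_simple a aP.
have saP : s_ a \in WP by exact/mem_gen/imset_f.
have [s [sD sl Ew]] := reduced_word B w.
apply: contraLR (min_w _ saP); rewrite -ltnNge {1}Ew.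
case/(exchange sD aD) => t [tD st Et].
by rewrite -sl Ew Et -st ltnS weyl_length_le.
Qed.

Lemma pos_levi w a :
    (forall c, c \in P -> pos (wroot w c)) -> levi_root P a -> pos a ->
  pos (wroot w a).
Proof.
move=> wP /levi_rootP la /pos_rootP pa; apply/pos_rootP => b.
rewrite simple_coef_wroot; apply: sumr_ge0 => c _.
have [cP|cP] := boolP (c \in P); last by rewrite la // mul0r.
by rewrite mulr_ge0 ?(pos_rootP _ _ (wP c cP)).
Qed.

(** Both w and w u make the roots of P positive, hence u preserves the
    positivity of the roots of the Levi part; u also preserves the sign of all
    other roots. *)
Lemma minreps_uniq w u :
  w \in minreps W B P -> u \in WP -> (w * u)%g \in minreps W B P -> u = 1%g.
Proof.
move=> wM uP wuM; apply: (pos_simple_eq1 (B := B)) => c cD.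
have [cP|cP] := boolP (c \in P); last first.
  apply: (@pos_root_gt0 _ _ _ c).
  by rewrite simple_coef_WP // simple_coef_simple // eqxx.
apply: contraT; rewrite -(pos_opp W) => neg.
have lc : levi_root P c.
  apply/levi_rootP => b bP; rewrite simple_coef_simple //.
  by case: eqVneq => // cb; rewrite -cb cP in bP.
have := pos_levi (fun c => @minrep_pos w c wM) _ neg.
rewrite levi_root_opp levi_root_WP // => /(_ lc).
by rewrite wroot_opp pos_opp -wrootM (minrep_pos wuM cP).
Qed.

Local Notation mr := (minrep (W := W) B P).

Lemma minrep_ofP w : (w^-1 * minrep_of B P w)%g \in WP.
Proof.
rewrite /minrep_of; case: arg_minnP => [|u]; first exact: lcoset_refl.
by rewrite mem_lcoset.
Qed.

Lemma minrep_eqP v w : reflect (mr v = mr w) (v^-1 * w \in WP)%g.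
Proof.
have v1 := minrep_ofP v; have w1 := minrep_ofP w.
set x := minrep_of B P v in v1; set y := minrep_of B P w in w1.
have xy : (v^-1 * w \in WP)%g = (x^-1 * y \in WP)%g.
  have -> : (x^-1 * y = (v^-1 * x)^-1 * (v^-1 * w) * (w^-1 * y))%g.
    by rewrite invMg invgK !mulgA !mulgK.
  by rewrite (groupMr _ w1) (groupMl _ (groupVr v1)).
rewrite xy; apply: (iffP idP) => [{}xy|E].
  have Ey : (x * (x^-1 * y) = y)%g by rewrite mulKVg.
  apply: val_inj => /=; rewrite -/x -/y -Ey.
  rewrite (minreps_uniq (w := x) _ xy) ?mulg1 ?Ey //; exact: minrep_of_subproof.
by have /= := congr1 val E; rewrite -/x -/y => ->; rewrite mulVg group1.
Qed.

Lemma minrep_val (x : Wquo W B P) : mr (val x) = x.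
Proof.
have xP := minrep_ofP (val x); apply: val_inj => /=.
have := minreps_uniq (valP x) xP; rewrite mulKVg.
move=> /(_ (minrep_of_subproof _ _ _)).
by move/(canRL (mulKVg _)); rewrite mulg1.
Qed.

Lemma minrepM u v w : mr v = mr w -> mr (u * v)%g = mr (u * w)%g.
Proof.
move/minrep_eqP => vw; apply/minrep_eqP.
by rewrite invMg -mulgA mulKg.
Qed.

Lemma minrep_mul_val v w : mr (v * val (mr w))%g = mr (v * w)%g.
Proof. by apply: minrepM; rewrite minrep_val. Qed.

End Parabolic.

(** * The localization Q and sums over the Weyl group *)

Section Localization.
Variables (D : root_datum) (W : weyl_group D) (R : comNzRingType) (F : fgl R).
Variable Q : wlocalization W F.
Implicit Types (a b c : ridx D) (u v w : W) (p q : Q).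

Local Notation loc := (loc_map Q).
Local Notation act := (qact Q).
Local Notation s_ := (srefl W).

Lemma weyl_mx_additive w :
  {morph mulmx (weyl_mx w) : x y / x + y :> 'cV[int]_(rk D)}.
Proof. exact: mulmxDr. Qed.

Lemma weyl_act_x w a : weyl_act w (x_root F a) = x_root F (wroot w a).
Proof.
rewrite /weyl_act /x_root wrootE; apply: fgr_map_x; exact: weyl_mx_additive.
Qed.

Lemma weyl_actM u v (s : fgr F 'cV[int]_(rk D)) :
  weyl_act u (weyl_act v s) = weyl_act (u * v)%g s.
Proof.
rewrite /weyl_act fgr_map_comp; try exact: weyl_mx_additive.
apply: (congr1 (fun h => fgr_map h s)); apply/funext => x /=.
by rewrite weyl_mxM mulmxA.
Qed.

Lemma weyl_act1 (s : fgr F 'cV[int]_(rk D)) : weyl_act (1%g : W) s = s.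
Proof.
rewrite -[RHS]fgr_map_id /weyl_act; apply: (congr1 (fun h => fgr_map h s)).
by apply/funext => x; rewrite weyl_mx1 mul1mx.
Qed.

Lemma qx_unit a : qx Q a \is a GRing.unit.
Proof. by apply: (@loc_unit _ _ Q); exists a. Qed.

Lemma loc_morph_eq (f g : {rmorphism Q -> Q}) :
  (forall s, f (loc s) = g (loc s)) -> f =1 g.
Proof.
move=> fg q; have [s [t [tX E]]] := loc_frac (l := Q) q.
have ut : loc (\prod_(x <- t) x) \is a GRing.unit.
  rewrite rmorph_prod big_seq.
  elim/big_ind: _ => [||x /tX]; [exact: unitr1 | | exact: loc_unit].
  by move=> x y ux uy; rewrite unitrM ux.
have ug : g (loc (\prod_(x <- t) x)) \is a GRing.unit by exact: rmorph_unit.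
by apply: (mulIr ug); rewrite -{1}fg -!rmorphM /= E fg.
Qed.

Lemma qactM u v q : act u (act v q) = act (u * v)%g q.
Proof.
apply: (loc_morph_eq (f := act u \o act v)) => s /=.
by rewrite !qact_map weyl_actM.
Qed.

Lemma qact1 q : act 1%g q = q.
Proof.
apply: (loc_morph_eq (g := idfun)) => s /=.
by rewrite qact_map weyl_act1.
Qed.

Lemma qact_srefl2 a q : act (s_ a) (act (s_ a) q) = q.
Proof. by rewrite qactM srefl2 qact1. Qed.

Lemma qact_x w a : act w (qx Q a) = qx Q (wroot w a).
Proof. by rewrite /qx qact_map weyl_act_x. Qed.

Lemma in_S_loc s : in_S (loc s).
Proof. by exists s. Qed.

Lemma in_S0 : in_S (0 : Q).
Proof. by exists 0; rewrite rmorph0. Qed.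

Lemma in_S1 : in_S (1 : Q).
Proof. by exists 1; rewrite rmorph1. Qed.

Lemma in_S_D p q : in_S p -> in_S q -> in_S (p + q).
Proof. by move=> [s ->] [t ->]; exists (s + t); rewrite rmorphD. Qed.

Lemma in_S_N p : in_S p -> in_S (- p).
Proof. by move=> [s ->]; exists (- s); rewrite rmorphN. Qed.

Lemma in_S_M p q : in_S p -> in_S q -> in_S (p * q).
Proof. by move=> [s ->] [t ->]; exists (s * t); rewrite rmorphM. Qed.

Lemma in_S_act w p : in_S p -> in_S (act w p).
Proof. by move=> [s ->]; rewrite qact_map; exact: in_S_loc. Qed.

(** Units of S inside Q. As q^-1 = q for a nonunit q of Q, invertibility in Q
    has to be required separately. *)
Definition unit_S q := [/\ q \is a GRing.unit, in_S q & in_S q^-1].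

Lemma unit_S1 : unit_S 1.
Proof. by split; rewrite ?invr1 ?unitr1 //; exact: in_S1. Qed.

Lemma unit_S_N p : unit_S p -> unit_S (- p).
Proof.
by case=> up Sp Spi; split; rewrite ?unitrN ?invrN //; exact: in_S_N.
Qed.

Lemma unit_S_M p q : unit_S p -> unit_S q -> unit_S (p * q).
Proof.
case=> up Sp Spi [uq Sq Sqi]; split; first by rewrite unitrM up.
  exact: in_S_M.
by rewrite invrM //; exact: in_S_M.
Qed.

Lemma unit_S_act w p : unit_S p -> unit_S (act w p).
Proof.
case=> up Sp Spi; split; [exact: rmorph_unit | exact: in_S_act | ].
by rewrite -rmorphV //; exact: in_S_act.
Qed.

Lemma sum_demazure a (h : W -> Q) :
  \sum_v demazure_elt Q a v * h v = (qx Q a)^-1 * (h 1%g - h (s_ a)).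
Proof.
rewrite mulrBr.
have E (c : W) : \sum_v (qx Q a)^-1 * (v == c)%:R * h v = (qx Q a)^-1 * h c.
  rewrite (bigD1 c) //= eqxx mulr1 big1 ?addr0 // => v /negPf ->.
  by rewrite mulr0 mul0r.
rewrite -!E -sumrB; apply: eq_bigr => v _.
by rewrite !ffunE mulrBr mulrBl.
Qed.

Lemma sum_delta w (h : W -> Q) : \sum_v delta Q w v * h v = h w.
Proof.
rewrite (bigD1 w) //= ffunE eqxx mul1r big1 ?addr0 // => v /negPf nvw.
by rewrite ffunE nvw mul0r.
Qed.

Lemma sum_scale q (z : QW Q) (h : W -> Q) :
  \sum_v qw_scale q z v * h v = q * \sum_v z v * h v.
Proof. by rewrite mulr_sumr; apply: eq_bigr => v _; rewrite ffunE mulrA. Qed.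

Lemma qw_mul_sum (z z' : QW Q) (h : W -> Q) :
  \sum_u qw_mul z z' u * h u =
    \sum_v z v * \sum_u act v (z' u) * h (v * u)%g.
Proof.
under eq_bigr do rewrite ffunE mulr_suml.
rewrite exchange_big; apply: eq_bigr => v _ /=.
rewrite mulr_sumr (reindex_inj (mulgI v)); apply: eq_bigr => u _ /=.
by rewrite mulKg mulrA.
Qed.

(** Elements of Q_W are compared as functionals on functions W -> Q, for which
    the sums against delta_w, X_a and products have closed forms. *)
Lemma qw_ext (z z' : QW Q) :
  (forall h : W -> Q, \sum_v z v * h v = \sum_v z' v * h v) -> z = z'.
Proof.
move=> E; apply/ffunP => u; have := E (fun v => delta Q u v).
under eq_bigr do rewrite mulrC.
under [in RHS]eq_bigr do rewrite mulrC.
by rewrite !(sum_delta u).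
Qed.

Lemma srefl_in_D a : in_D (delta Q (s_ a)).
Proof.
have -> : delta Q (s_ a) = qw_scale (loc 1) (delta Q 1%g) +
    qw_mul (qw_scale (loc (- x_root F a)) (delta Q 1%g)) (demazure_elt Q a).
  apply: qw_ext => h; rewrite sum_delta.
  under eq_bigr do rewrite ffunE mulrDl.
  rewrite big_split /= sum_scale sum_delta rmorph1 mul1r.
  rewrite qw_mul_sum sum_scale sum_delta.
  under eq_bigr do rewrite qact1 mul1g.
  rewrite sum_demazure rmorphN mulNr mulrA mulrV ?mul1r ?opprB.
    by rewrite addrC subrK.
  exact: qx_unit.
by do !constructor.
Qed.

Lemma delta_in_D w : in_D (delta Q w).
Proof.
elim/weyl_ind: w => [|a w IHw].
  have -> : delta Q 1%g = qw_scale (loc 1) (delta Q 1%g).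
    by apply: qw_ext => h; rewrite sum_scale sum_delta rmorph1 mul1r.
  exact: in_D_S.
have -> : delta Q (s_ a * w)%g = qw_mul (delta Q (s_ a)) (delta Q w).
  apply: qw_ext => h; rewrite qw_mul_sum !sum_delta.
  transitivity (\sum_u delta Q w u * h (s_ a * u)%g).
    by rewrite sum_delta.
  by apply: eq_bigr => u _; rewrite ffunE rmorph_nat.
by apply: in_D_mul => //; exact: srefl_in_D.
Qed.

End Localization.

(** * The dual module D_P^* and the class of a point *)

Section DualModule.
Variables (D : root_datum) (W : weyl_group D) (B : base D) (P : {set ridx D}).
Hypothesis P_simple : P \subset simple B.
Variables (R : comNzRingType) (F : fgl R) (Q : wlocalization W F).
Implicit Types (a b c : ridx D) (u v w : W) (p q : Q).
Implicit Types (z : QW Q) (g h : Qdual Q B P).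

Local Notation loc := (loc_map Q).
Local Notation act := (qact Q).
Local Notation s_ := (srefl W).
Local Notation mr := (minrep (W := W) B P).
Local Notation DP := (DPdual_pred (P := P)).

Lemma odotE z g w :
  odot z g (mr w) = \sum_v z v * act v (g (mr (v^-1 * w)%g)).
Proof.
rewrite ffunE; apply: eq_bigr => v _.
rewrite (big_pred1 (mr (v^-1 * w)%g)) // => x /=.
apply/eqP/eqP => [E|->].
  by rewrite -[x](minrep_val P_simple) -(mulKg v (val x)); exact: minrepM.
by rewrite (minrep_mul_val P_simple) mulKVg.
Qed.

Lemma Qdual_ext g h : (forall w, g (mr w) = h (mr w)) -> g = h.
Proof.
by move=> E; apply/ffunP => x; rewrite -[x](minrep_val P_simple) E.
Qed.

Lemma odot_mul z z' g : odot (qw_mul z z') g = odot z (odot z' g).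
Proof.
apply: Qdual_ext => w; rewrite !odotE qw_mul_sum; apply: eq_bigr => v _.
rewrite odotE rmorph_sum; congr (_ * _); apply: eq_bigr => u _ /=.
by rewrite rmorphM qactM invMg mulgA.
Qed.

Lemma odotDl z z' g : odot (z + z') g = odot z g + odot z' g.
Proof.
apply: Qdual_ext => w; rewrite [RHS]ffunE !odotE -big_split.
by apply: eq_bigr => v _; rewrite ffunE mulrDl.
Qed.

Lemma odot_scale1 q g : odot (qw_scale q (delta Q 1%g)) g = qdual_scale q g.
Proof.
apply: Qdual_ext => w.
by rewrite odotE sum_scale sum_delta ffunE invg1 mul1g qact1.
Qed.

Lemma odot_delta v g w :
  odot (delta Q v) g (mr w) = act v (g (mr (v^-1 * w)%g)).
Proof. by rewrite odotE sum_delta. Qed.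

Lemma odot_demazure a g w :
  odot (demazure_elt Q a) g (mr w) =
    (qx Q a)^-1 * (g (mr w) - act (s_ a) (g (mr (s_ a * w)%g))).
Proof. by rewrite odotE sum_demazure invg1 mul1g qact1 sreflV. Qed.

Definition pair_QW g z : Q := \sum_w z w * g (mr w).

Lemma pair_QWE g z : qeval g (qquo_proj B P z) = pair_QW g z.
Proof.
rewrite /qeval /pair_QW (partition_big mr predT) //=.
apply: eq_bigr => x _; rewrite ffunE mulr_sumr.
by apply: eq_bigr => w /eqP <-; rewrite mulrC.
Qed.

Lemma DPdualP g : reflect (forall z, in_D z -> in_S (pair_QW g z)) (g \in DP).
Proof.
by apply: (iffP (asboolP _)) => h z /h; rewrite ?pair_QWE.
Qed.

Lemma pair_demazure a g z :
  pair_QW g (qw_mul (demazure_elt Q a) z) =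
    (qx Q a)^-1 *
      (pair_QW g z - act (s_ a) (pair_QW (odot (delta Q (s_ a)) g) z)).
Proof.
rewrite /pair_QW qw_mul_sum sum_demazure; congr (_ * (_ - _)).
  by apply: eq_bigr => u _; rewrite qact1 mul1g.
rewrite rmorph_sum; apply: eq_bigr => u _ /=.
by rewrite rmorphM odot_delta qact_srefl2 sreflV.
Qed.

Lemma pair_delta_srefl a g z :
  pair_QW g (qw_mul (delta Q (s_ a)) z) =
    act (s_ a) (pair_QW (odot (delta Q (s_ a)) g) z).
Proof.
rewrite /pair_QW qw_mul_sum sum_delta rmorph_sum; apply: eq_bigr => u _ /=.
by rewrite rmorphM odot_delta qact_srefl2 sreflV.
Qed.

Hypothesis criterion : CZZ_criterion Q B P.

(** The constant function 1 satisfies the criterion, and its value on X_a p is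
    this quotient. *)
Lemma divided_difference a p :
  in_S p -> in_S ((qx Q a)^-1 * (p - act (s_ a) p)).
Proof.
case=> s ->.
have /DPdualP one : ([ffun=> 1] : Qdual Q B P) \in DP.
  apply/criterion; split=> [w|w b _]; first by rewrite ffunE; exact: in_S1.
  by exists 0; rewrite !ffunE subrr rmorph0 mulr0.
have := one _ (in_D_mul (in_D_X Q a) (in_D_S Q s)).
have E (h : Qdual Q B P) : (forall x, h x = 1) ->
    pair_QW h (qw_scale (loc s) (delta Q 1%g)) = loc s.
  by move=> h1; rewrite /pair_QW sum_scale sum_delta h1 mulr1.
rewrite pair_demazure !E // => x; last by rewrite ffunE.
by rewrite -[x](minrep_val P_simple) odot_delta ffunE rmorph1.
Qed.

(** For X_a this is the twisted Leibniz rule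
    <X_a g, z> = <g, X_a z> + X_a (<g, delta_a z>). *)
Lemma odot_DPdual z g : in_D z -> g \in DP -> odot z g \in DP.
Proof.
move=> Dz; elim: Dz g => {z} [s|a|z z' _ IH _ IH'|z z' _ IH _ IH'] g.
all: move=> /DPdualP gD.
- apply/DPdualP => z /gD; rewrite odot_scale1 => zS.
  rewrite (_ : pair_QW _ _ = loc s * pair_QW g z).
    by apply: in_S_M => //; exact: in_S_loc.
  rewrite mulr_sumr; apply: eq_bigr => w _.
  by rewrite ffunE mulrCA.
- apply/DPdualP => z Dz; set h := odot (delta Q (s_ a)) g.
  have -> : pair_QW (odot (demazure_elt Q a) g) z =
      (qx Q a)^-1 * (pair_QW g z - pair_QW h z).
    rewrite /pair_QW -sumrB mulr_sumr; apply: eq_bigr => w _.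
    by rewrite odot_demazure /h odot_delta sreflV mulrCA mulrBr.
  have hS : in_S (act (s_ a) (pair_QW h z)).
    rewrite -pair_delta_srefl; apply: gD; apply: in_D_mul => //.
    exact: srefl_in_D.
  have := in_S_D (gD _ (in_D_mul (in_D_X Q a) Dz)) (divided_difference a hS).
  by rewrite pair_demazure -mulrDr addrA subrK qact_srefl2.
- by rewrite odotDl; apply: rpredD; [apply: IH|apply: IH']; apply/DPdualP.
- by rewrite odot_mul; apply/IH/IH'/DPdualP.
Qed.

(** Dividing x_a - s_a(x_a) = x_a - x_{-a} by x_a shows that x_a divides
    x_{-a}; by symmetry the quotient is a unit. *)
Lemma qx_opp a : exists2 e, unit_S e & qx Q (opp_root W a) = e * qx Q a.
Proof.
have key c : in_S ((qx Q c)^-1 * qx Q (opp_root W c)).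
  have := divided_difference c (in_S_loc Q (x_root F c)).
  rewrite -/(qx Q c) qact_x -/(opp_root W c) mulrBr mulVr ?qx_unit // => h.
  have := in_S_D (in_S1 Q) (in_S_N h).
  by rewrite opprB addrCA subrr addr0.
exists ((qx Q a)^-1 * qx Q (opp_root W a)).
  split; first by rewrite unitrM unitrV !qx_unit.
    exact: key.
  have := key (opp_root W a); rewrite opp_rootK.
  by rewrite invrM ?unitrV ?qx_unit // invrK.
by rewrite mulrAC mulVr ?mul1r ?qx_unit.
Qed.

Local Notation out_pos := (out_pos B P).
Local Notation out_neg := (out_neg B P).
Local Notation X := (x_Pi_over_P Q B P).

Lemma x_Pi_over_PE : X = \prod_(a | out_neg a) qx Q a.
Proof.
rewrite /x_Pi_over_P (bigID (levi_root P)) /=.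
under eq_bigl do rewrite andbC.
rewrite mulrC mulrA mulVr ?mul1r.
  by apply: eq_bigl => a; rewrite (out_negE W) // negative_rootE.
elim/big_ind: _ => [|x y ux uy|a _]; rewrite ?unitr1 ?qx_unit //.
by rewrite unitrM ux.
Qed.

Lemma in_S_prod (I : finType) (K : pred I) (f : I -> Q) :
  (forall i, K i -> in_S (f i)) -> in_S (\prod_(i | K i) f i).
Proof.
by move=> fS; elim/big_ind: _ => //; [exact: in_S1 | exact: in_S_M].
Qed.

Lemma x_Pi_over_P_in_S : in_S X.
Proof.
rewrite x_Pi_over_PE; apply: in_S_prod => a _; exact: in_S_loc.
Qed.

(** One of b and -b is a factor of x_{Pi/P}. *)
Lemma x_Pi_over_P_dvd b : ~~ levi_root P b -> x_dvd b X.
Proof.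
have key c : out_neg c -> exists2 t, in_S t & X = qx Q c * t.
  move=> oc; rewrite x_Pi_over_PE (bigD1 c) //=.
  by eexists; last reflexivity; apply: in_S_prod => a _; exact: in_S_loc.
move=> lb; have [pb|nb] := boolP (pos_root B b); last first.
  have [|_ [t ->] ->] := key b; first by rewrite (out_negE W) // nb.
  by exists t.
have [|t tS ->] := key (opp_root W b).
  by rewrite out_neg_opp out_posE // pb.
have [e [_ eS _] ->] := qx_opp b.
have [s Es] := in_S_M eS tS; exists s.
by rewrite -Es mulrA [qx Q b * e]mulrC.
Qed.

Definition point_class : Qdual Q B P := qdual_scale X (fdual Q (mr 1%g)).
Local Notation pt := point_class.

Lemma point_classE w : pt (mr w) = X * (w \in WP_group W P)%:R.
Proof.
have := minrep_eqP P_simple 1%g w; rewrite invg1 mul1g => coset_w.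
by rewrite !ffunE eq_sym (sameP eqP coset_w).
Qed.

(** A difference of values is nonzero only if exactly one of w and s_{w(a)} w
    lies in W_P, and then w(a) is outside the Levi part. *)
Lemma point_class_DPdual : pt \in DP.
Proof.
apply/criterion; split=> [x|x a la].
  rewrite -[x](minrep_val P_simple) point_classE.
  apply: in_S_M; first exact: x_Pi_over_P_in_S.
  by case: (_ \in _); [exact: in_S1 | exact: in_S0].
rewrite -{2}[x](minrep_val P_simple) /refl_coset !point_classE.
set w := val x; set b := wroot w a; rewrite -mulrBr.
have x_dvd0 : x_dvd b (0 : Q) by exists 0; rewrite rmorph0 mulr0.
have [wP|wP] := boolP (w \in _); have [uP|uP] := boolP ((s_ b * w)%g \in _);
    rewrite ?subrr ?mulr0 // ?subr0 ?sub0r ?mulrN ?mulr1.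
  by apply: x_Pi_over_P_dvd; rewrite (levi_root_WP P_simple).
have [|t ->] := @x_Pi_over_P_dvd b.
  rewrite -(levi_root_opp W P_simple).
  have -> : opp_root W b = wroot (s_ b * w)%g a by rewrite wrootM.
  by rewrite (levi_root_WP P_simple _ uP).
by exists (- t); rewrite rmorphN mulrN.
Qed.

End DualModule.

(** * Inversions of a coset *)

Local Opaque minrep.

Section Inversions.
Variables (D : root_datum) (W : weyl_group D) (B : base D) (P : {set ridx D}).
Hypothesis P_simple : P \subset simple B.
Implicit Types (a b c : ridx D) (u v w : W).

Local Notation s_ := (srefl W).
Local Notation pos := (pos_root B).
Local Notation out_pos := (out_pos B P).
Local Notation out_neg := (out_neg B P).
Local Notation mr := (minrep (W := W) B P).

(** For minimal w these are the inversions of w^-1. Leaving out the roots of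
    the Levi part makes the set depend on the coset w W_P only, so that no
    choice of a representative is involved. *)
Definition coset_inv w : {set ridx D} :=
  [set b | pos b && out_neg (wroot w^-1%g b)].

Definition coset_length w := #|coset_inv w|.

Lemma in_coset_inv w b :
  (b \in coset_inv w) = pos b && out_neg (wroot w^-1%g b).
Proof. by rewrite inE. Qed.

Lemma coset_inv_minrep v w : mr v = mr w -> coset_inv v = coset_inv w.
Proof.
move/(introT (minrep_eqP P_simple v w)) => vw; apply/setP => b.
rewrite [LHS]in_coset_inv.
rewrite [RHS]in_coset_inv.
have -> : (v^-1 = (v^-1 * w) * w^-1)%g by rewrite mulgK.
by rewrite wrootM out_neg_WP.
Qed.

Lemma coset_length_minrep v w :
  mr v = mr w -> coset_length v = coset_length w.
Proof. by move=> /coset_inv_minrep vw; rewrite /coset_length vw. Qed.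

Lemma out_neg_srefl w a :
  out_neg (wroot (s_ a * w)^-1%g a) = out_pos (wroot w^-1%g a).
Proof.
by rewrite invMg sreflV wrootM -/(opp_root W a) wroot_opp out_neg_opp.
Qed.

(** The reflection s_a permutes the positive roots other than a. *)
Lemma coset_inv_srefl w a : a \in simple B -> out_neg (wroot w^-1%g a) ->
  coset_inv w = a |: wroot (s_ a) @: coset_inv (s_ a * w)%g /\
  a \notin wroot (s_ a) @: coset_inv (s_ a * w)%g.
Proof.
move=> aD neg_a; have pa := simple_pos aD.
have sK : involutive (wroot (s_ a)) by move=> b; rewrite -wrootM srefl2 wroot1.
have image_invE b : (b \in wroot (s_ a) @: coset_inv (s_ a * w)%g) =
    pos (wroot (s_ a) b) && out_neg (wroot w^-1%g b).
  rewrite -{1}[b]sK (mem_imset _ _ (can_inj sK)) inE.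
  by rewrite invMg sreflV wrootM sK.
split; last by rewrite image_invE -/(opp_root W a) pos_opp pa.
apply/setP => b; rewrite !inE image_invE; have [->|nba] /= := eqVneq b a.
  by rewrite pa neg_a.
have [pb|nb] := boolP (pos b); first by rewrite pos_srefl.
apply/esym; have [Eb|nba'] := eqVneq b (opp_root W a).
  apply/negbTE/nandP; right; rewrite Eb wroot_opp out_neg_opp out_posE //.
  by move: neg_a; rewrite (out_negE W) // => /andP[/negPf ->].
apply/negbTE/nandP; left; rewrite -(pos_opp W) -wroot_opp pos_srefl ?pos_opp //.
by apply: contra_neq nba' => <-; rewrite opp_rootK.
Qed.

Lemma coset_length_neg w a : a \in simple B -> out_neg (wroot w^-1%g a) ->
  coset_length w = (coset_length (s_ a * w)%g).+1.
Proof.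
move=> aD neg_a; have [E aN] := coset_inv_srefl aD neg_a.
rewrite /coset_length E cardsU1 aN card_imset //.
exact: can_inj (wrootK _).
Qed.

Lemma coset_length_pos w a : a \in simple B -> out_pos (wroot w^-1%g a) ->
  coset_length (s_ a * w)%g = (coset_length w).+1.
Proof.
move=> aD; rewrite -out_neg_srefl => neg_a.
by rewrite (coset_length_neg aD neg_a) mulgA srefl2 mul1g.
Qed.

Lemma coset_length_srefl w a : a \in simple B ->
  (coset_length (s_ a * w)%g <= (coset_length w).+1)%N.
Proof.
move=> aD.
have sub : coset_inv (s_ a * w)%g \subset a |: wroot (s_ a) @: coset_inv w.
  apply/subsetP => b; rewrite !inE => /andP[pb]; rewrite invMg sreflV wrootM.
  have [//|nba] /= := eqVneq b a => neg_b.
  apply/imsetP; exists (wroot (s_ a) b); last by rewrite -wrootM srefl2 wroot1.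
  by rewrite inE pos_srefl.
apply: leq_trans (subset_leq_card sub) _.
rewrite cardsU1 card_imset; last exact: can_inj (wrootK _).
by rewrite -add1n leq_add2r leq_b1.
Qed.

End Inversions.

(** * Generation of D_P^* by the class of a point *)

Section Generation.
Variables (D : root_datum) (W : weyl_group D) (B : base D) (P : {set ridx D}).
Hypothesis P_simple : P \subset simple B.
Variables (R : comNzRingType) (F : fgl R) (Q : wlocalization W F).
Hypothesis criterion : CZZ_criterion Q B P.
Implicit Types (a b c : ridx D) (u v w : W) (p q : Q).
Implicit Types (z : QW Q) (g h : Qdual Q B P).

Local Notation loc := (loc_map Q).
Local Notation act := (qact Q).
Local Notation s_ := (srefl W).
Local Notation mr := (minrep (W := W) B P).
Local Notation DP := (DPdual_pred (P := P)).
Local Notation pos := (pos_root B).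
Local Notation out_pos := (out_pos B P).
Local Notation out_neg := (out_neg B P).
Local Notation X := (x_Pi_over_P Q B P).
Local Notation pt := (point_class B P Q).
Local Notation len := (coset_length B P).
Local Notation inv := (coset_inv B P).

Local Opaque odot coset_length coset_inv.

(** The x_b for b in coset_inv w belong to the positive tangent weights of G/P
    at the fixed point w. These span the normal space of the opposite cell
    B^- w P / P, and the product is its Euler class. *)
Definition euler w : Q := \prod_(b in inv w) qx Q b.

Lemma euler_unit w : euler w \is a GRing.unit.
Proof.
rewrite /euler.
elim/big_ind: _ => [|x y ux uy|b _]; rewrite ?unitr1 ?qx_unit //.
by rewrite unitrM ux.
Qed.

Lemma euler_srefl w a : a \in simple B -> out_neg (wroot w^-1%g a) ->
  euler w = qx Q a * act (s_ a) (euler (s_ a * w)%g).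
Proof.
move=> aD neg_a; have [E aN] := coset_inv_srefl P_simple aD neg_a.
rewrite /euler E big_setU1 //= big_imset /=; last first.
  by move=> b c _ _; exact: can_inj (wrootK _) _ _.
by rewrite rmorph_prod; congr (_ * _); apply: eq_bigr => b _; rewrite qact_x.
Qed.

(** Induction on the length. If w^-1(a) is negative outside the Levi part,
    then s_a w is shorter and e_w = x_a s_a(e_{s_a w}), so X_a turns a
    functional for s_a w into one for w: on g supported in length at least len
    w the term without delta_a vanishes. If no simple root a is available,
    then w has length 0 and evaluation at w will do. *)
Lemma leading_functional w :
  exists z, in_D z /\ exists2 e, unit_S e &
    forall g, (forall v, (len v < len w)%N -> g (mr v) = 0) ->
      pair_QW g z = e / euler w * g (mr w).
Proof.
have [n] := ubnP (len w); elim: n w => // n IHn w lt_wn.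
have [/exists_inP[a aD neg_a]|/exists_inPn h] :=
  boolP [exists a in simple B, out_neg (wroot w^-1%g a)]; last first.
  exists (delta Q w); split; first exact: delta_in_D.
  exists 1; first exact: unit_S1.
  move=> g _; rewrite /pair_QW sum_delta /euler big_pred0 ?divr1 ?mul1r // => b.
  rewrite in_coset_inv; apply/negbTE/nandP.
  have [pb|_] := boolP (pos b); [right|by left].
  by apply/negP => /(simple_out_neg pb)[a aD]; apply/negP; exact: h.
have len_w := coset_length_neg P_simple aD neg_a.
have [w' Ew'] : exists w', (s_ a * w)%g = w' by eexists.
rewrite Ew' in len_w.
have [|z [Dz [e eS Ez]]] := IHn w'; first by rewrite len_w in lt_wn.
exists (qw_mul (demazure_elt Q a) z).
split; first exact: in_D_mul (in_D_X Q a) Dz.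
exists (- act (s_ a) e); first exact/unit_S_N/unit_S_act.
move=> g g0; rewrite (pair_demazure P_simple).
have -> : pair_QW g z = 0.
  have g0' : g (mr w') = 0 by apply: g0; rewrite len_w.
  rewrite Ez; first by rewrite g0' mulr0.
  by move=> v lt_v; apply: g0; rewrite len_w ltnW.
rewrite sub0r.
have -> := Ez (odot (delta Q (s_ a)) g); last first.
  move=> v lt_v; rewrite (odot_delta P_simple) sreflV.
  have -> : g (mr (s_ a * v)%g) = 0; last exact: rmorph0.
  apply: g0; apply: leq_ltn_trans (coset_length_srefl P v aD) _.
  by rewrite len_w ltnS.
have w'K : (s_ a * w')%g = w by rewrite -Ew' mulgA srefl2 mul1g.
rewrite (odot_delta P_simple) sreflV w'K.
rewrite rmorphM qact_srefl2 (euler_srefl aD neg_a) Ew' rmorphM.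
rewrite rmorphV ?euler_unit //.
rewrite invrM ?qx_unit ?rmorph_unit ?euler_unit //.
rewrite !mulNr mulrN; congr (- _); move: (act _ e) (act _ _)^-1 => x y.
by rewrite !mulrA; congr (_ * _); rewrite -mulrA mulrC.
Qed.

(** Descending induction on the length. If w^-1(a) is positive outside the
    Levi part, then s_a w is longer and X_a turns an element for s_a w into
    one for w. If no simple root a is available, then every root b with
    w^-1(b) negative outside the Levi part is positive, and delta_w [pt] has
    value w(x_{Pi/P}) = e_w at w and 0 elsewhere. *)
Lemma leading_element w :
  exists z, in_D z /\ exists2 e, unit_S e &
    odot z pt (mr w) = e * euler w /\
    forall v, (len v <= len w)%N -> mr v != mr w -> odot z pt (mr v) = 0.
Proof.
have len_max v : (len v <= #|ridx D|)%N by exact: max_card.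
have [n] := ubnP (#|ridx D| - len w)%N; elim: n w => // n IHn w lt_wn.
have [/exists_inP[a aD pos_a]|/exists_inPn h] :=
  boolP [exists a in simple B, out_pos (wroot w^-1%g a)]; last first.
  exists (delta Q w); split; first exact: delta_in_D.
  exists 1; first exact: unit_S1.
  split.
    rewrite (odot_delta P_simple) mulVg (point_classE P_simple).
    rewrite group1 mulr1 mul1r.
    rewrite x_Pi_over_PE // rmorph_prod.
    rewrite (reindex_inj (can_inj (wrootVK w))) /euler.
    apply: eq_big => [b|b _]; last by rewrite qact_x wrootVK.
    rewrite in_coset_inv; have [//|nb] := boolP (pos b).
    apply/negbTE/negP => neg_b.
    have [||a aD] := @simple_out_pos _ _ B P w^-1%g (opp_root W b).
    - by rewrite pos_opp.
    - by rewrite wroot_opp out_pos_opp.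
    by apply/negP; exact: h.
  move=> v _ nvw; rewrite (odot_delta P_simple) (point_classE P_simple).
  case: (boolP (_ \in _)) => [vw|]; last by rewrite mulr0 rmorph0.
  by case/eqP: nvw; apply/esym/(minrep_eqP P_simple).
have len_w := coset_length_pos P_simple aD pos_a.
have [w' Ew'] : exists w', (s_ a * w)%g = w' by eexists.
rewrite Ew' in len_w.
have w'K : (s_ a * w')%g = w by rewrite -Ew' mulgA srefl2 mul1g.
have nww' : mr w != mr w'.
  by apply/eqP => /(coset_length_minrep P_simple); rewrite len_w; lia.
have [|z [Dz [e eS [Ez z0]]]] := IHn w'.
  by have := len_max w'; move: lt_wn; rewrite len_w; lia.
exists (qw_mul (demazure_elt Q a) z).
split; first exact: in_D_mul (in_D_X Q a) Dz.
have [e' e'S Ee'] := qx_opp P_simple criterion a.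
exists (- (act (s_ a) e * e')); first exact/unit_S_N/unit_S_M/e'S/unit_S_act.
split.
  have z0w : odot z pt (mr w) = 0 by apply: z0; rewrite ?len_w.
  have neg_a : out_neg (wroot w'^-1%g a) by rewrite -Ew' out_neg_srefl.
  have Ee : euler w' = qx Q a * act (s_ a) (euler w).
    by rewrite (euler_srefl aD neg_a) w'K.
  rewrite (odot_mul P_simple) (odot_demazure P_simple) Ew' z0w Ez Ee sub0r.
  rewrite !rmorphM qact_srefl2 qact_x -/(opp_root W a) Ee'.
  rewrite mulrN mulNr; congr (- _); rewrite !mulrA; congr (_ * _).
  by rewrite mulrC !mulrA mulrV ?mul1r ?qx_unit.
move=> v le_vw nvw; rewrite (odot_mul P_simple) (odot_demazure P_simple).
have zv : odot z pt (mr v) = 0.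
  apply: z0; first by rewrite len_w leqW.
  by apply/eqP => /(coset_length_minrep P_simple); rewrite len_w; lia.
have -> : odot z pt (mr (s_ a * v)%g) = 0.
  apply: z0; first by rewrite len_w (leq_trans (coset_length_srefl P v aD)).
  apply: contra nvw => /eqP /(minrepM P_simple (s_ a)).
  by rewrite w'K mulgA srefl2 mul1g => ->.
by rewrite zv rmorph0 subrr mulr0.
Qed.

Definition generated g := exists2 z, in_D z & g = odot z pt.

Lemma generated0 : generated 0.
Proof.
exists (qw_scale (loc 0) (delta Q 1%g)); first exact: in_D_S.
by rewrite odot_scale1 //; apply/ffunP => x; rewrite !ffunE rmorph0 mul0r.
Qed.

Lemma generatedD g h : generated g -> generated h -> generated (g + h).
Proof.
case=> z Dz -> [z' Dz' ->]; exists (z + z'); first exact: in_D_add.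
by rewrite odotDl.
Qed.

Lemma generatedZ q g : in_S q -> generated g -> generated (qdual_scale q g).
Proof.
case=> s -> [z Dz ->].
exists (qw_mul (qw_scale (loc s) (delta Q 1%g)) z).
  by apply: in_D_mul => //; exact: in_D_S.
by rewrite (odot_mul P_simple) odot_scale1.
Qed.

Lemma generated_DPdual g : generated g -> g \in DP.
Proof.
case=> z Dz ->; apply: odot_DPdual => //; exact: point_class_DPdual.
Qed.

(** Induction on j, for the elements supported in length greater than M - j,
    where M bounds all lengths. All cosets of the lowest length are cleared at
    once, since the elements that clear them do not interfere with each other.
    *)
Lemma DPdual_generated g : g \in DP -> generated g.
Proof.
have [M len_max] : exists M, forall v, (len v <= M)%N.
  by exists #|ridx D| => v; exact: max_card.
suff IH j : forall g, g \in DP ->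
    (forall v, (len v + j <= M)%N -> g (mr v) = 0) -> generated g.
  by move=> gD; apply: (IH M.+1) => // v; lia.
elim: j => [|j IHj] {}g gD g0.
  rewrite (_ : g = 0); first exact: generated0.
  by apply: Qdual_ext => // w; rewrite g0 ?addn0 // ffunE.
have layer (x : Wquo W B P) : exists h, (len (val x) + j)%N = M ->
    [/\ generated h, h x = g x &
      forall v, (len v <= len (val x))%N -> mr v != x -> h (mr v) = 0].
  rewrite -{2 3 5}[x](minrep_val P_simple); move: (val x) => {x}w.
  have [len_w|neq] := eqVneq (len w + j)%N M; last first.
    by exists 0 => /eqP; rewrite (negPf neq).
  have [z [Dz [e [ue _ eS] Ez]]] := leading_functional w.
  have [z' [Dz' [e' [ue' _ e'S] [Ez' z'0]]]] := leading_element w.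
  have /DPdualP/(_ z Dz) := gD; rewrite {}Ez; last first.
    move=> v; rewrite -(ltn_add2r j) -addnS len_w; exact: g0.
  move=> gwS; have euw := euler_unit w.
  (* The scalar is g(w) / (e' e_w); this form shows that it lies in S. *)
  exists (qdual_scale (e^-1 * (e / euler w * g (mr w)) * e'^-1) (odot z' pt)).
  move=> _; split.
  - apply: generatedZ; last by exists z'.
    by apply: in_S_M => //; apply: in_S_M.
  - rewrite ffunE Ez' mulrA mulrVK // !mulrA mulVr // mul1r.
    by rewrite mulrAC mulVr // mul1r.
  - by move=> v le_vw nvw; rewrite ffunE z'0 // mulr0.
have [H HP] := choice layer.
pose top (x : Wquo W B P) := (len (val x) + j)%N == M.
have genH : generated (\sum_(x | top x) H x).
  elim/big_ind: _ => [||x /eqP top_x]; [exact: generated0|exact: generatedD|].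
  by have [] := HP x top_x.
have : generated (g - \sum_(x | top x) H x).
  apply: IHj; first by rewrite rpredB // generated_DPdual.
  move=> v le_v; rewrite ffunE [X in _ + X]ffunE sum_ffunE.
  have H0 x : top x -> mr v != x -> H x (mr v) = 0.
    move=> /eqP top_x; have [_ _] := HP x top_x; apply.
    by rewrite -(leq_add2r j) top_x.
  have [top_v|ntop] := boolP (top (mr v)).
    rewrite (bigD1 (mr v)) //= big1 ?addr0; last first.
      by move=> x /andP[top_x]; rewrite eq_sym; exact: H0.
    by have [_ -> _] := HP _ (eqP top_v); rewrite subrr.
  rewrite big1 ?subr0 => [|x top_x]; last first.
    by apply: H0 => //; apply: contraNneq ntop => ->.
  apply: g0; rewrite addnS ltn_neqAle le_v andbT.
  by rewrite (coset_length_minrep P_simple (esym (minrep_val P_simple (mr v)))).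
move/generatedD => /(_ _ genH); by rewrite subrK.
Qed.

End Generation.

Theorem lemma5p4
  (D : root_datum) (W : weyl_group D) (B : base D)
  (P : {set ridx D}) (P_simple : P \subset simple B)
  (R : comNzRingType) (F : fgl R)
  (x_regular : forall a : ridx D, GRing.lreg (x_root F a))
  (Q : wlocalization W F)
  (criterion : CZZ_criterion Q B P)
  (phi : {additive Qdual Q B P -> Qdual Q B P}) (phi_E_Q : E_Q phi)
  (c : Wquo W B P -> Q)
  (phi_f1 : phi (fdual Q (minrep B P 1%g)) = 
     \sum_w qdual_scale (c w) (fdual Q w)) :
  comes_from_E_D phi <->
  forall w : Wquo W B P,
    in_S (x_Pi_over_P Q B P * c w) /\
    forall a : ridx D, ~~ levi_root P a ->
      x_dvd (wroot (val w) a)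
            (x_Pi_over_P Q B P * (c w - c (refl_coset w a))).
Proof.
have phi_pt w : phi (point_class B P Q) w = x_Pi_over_P Q B P * c w.
  rewrite /point_class -(odot_scale1 P_simple) phi_E_Q (odot_scale1 P_simple).
  rewrite ffunE phi_f1 sum_ffunE (bigD1 w) //= big1 ?addr0 => [|x nxw].
    by rewrite !ffunE eqxx mulr1.
  by rewrite !ffunE eq_sym (negPf nxw) mulr0.
have phi_ptP : phi (point_class B P Q) \in DPdual_pred (P := P) <->
    forall w, in_S (x_Pi_over_P Q B P * c w) /\
      forall a : ridx D, ~~ levi_root P a ->
        x_dvd (wroot (val w) a)
              (x_Pi_over_P Q B P * (c w - c (refl_coset w a))).
  split=> [/criterion [cS cd] w|h].
    rewrite -phi_pt; split=> // a la.
    by rewrite mulrBr -!phi_pt; exact: cd.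
  apply/criterion; split=> [w|w a la]; first by rewrite phi_pt; have [] := h w.
  by have [_ /(_ a la)] := h w; rewrite mulrBr -!phi_pt.
rewrite -phi_ptP; split=> [[psi [_ psiE]]|phi_pt_DP].
  rewrite (psiE (MkDPdual (point_class_DPdual P_simple criterion))).
  exact: valP.
have phi_DP g : g \in DPdual_pred (P := P) -> phi g \in DPdual_pred (P := P).
  case/(DPdual_generated P_simple criterion) => z Dz ->.
  by rewrite phi_E_Q; exact: odot_DPdual.
pose psi (g : DPdual Q B P) : DPdual Q B P := MkDPdual (phi_DP _ (valP g)).
have psi_additive : zmod_morphism psi.
  by move=> g h; apply: val_inj; rewrite /= raddfB.
pose addM := GRing.isZmodMorphism.Build _ _ psi psi_additive.
pose psiA : {additive DPdual Q B P -> DPdual Q B P} := HB.pack psi addM.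
exists psiA; split=> [z g g' Dz /= ->|//].
by rewrite phi_E_Q.
Qed.
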